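(* Let $\boldsymbol{\Xi}'$ and $\boldsymbol{\Xi}''$ be nodes of the upper level graph $\Gamma_U$ such that $\boldsymbol{\Xi}''$ is a descendant (child, child of child, ...) of $\boldsymbol{\Xi}'$. Then the weak cost of $\boldsymbol{\Xi}'$ is a lower bound on the cost of $\boldsymbol{\Xi}''$: $$\underline{\mathbb{V}}_U(\boldsymbol{\Xi}') \leq \mathbb{V}_U(\boldsymbol{\Xi}'').$$
   Context: **Data.** Gliders $i\in\{1,\dots,n_g\}$; interest points $ip_1,\dots,ip_{n_{ip}}$ at positions $p_{ip_j}\in\mathbb{R}^2$; thermals $t_1,\dots,t_{n_t}$ at positions $p_{t_k}\in\mathbb{R}^2$ with height gains $h_{t_k}>0$. Interest points and thermals are called waypoints. Glider $i$ has start position $p^0_i\in\mathbb{R}^2$, start orientation $\theta^0_i\in[-\pi,\pi]$, final position $p^f_i\in\mathbb{R}^2$ (symbol $f$), start height $h^0_i>0$. Constants: $\kappa_{max},\sigma_{max}>0$ and a descent angle $\gamma_{d_{min}}\in(0,\pi/2)$. **Geometric constants.** $\theta_{lim}=\kappa_{max}^2/\sigma_{max}$; $x_\Omega=\int_0^{\kappa_{max}/\sigma_{max}}\cos(\sigma_{max}u^2/2)\,du-\sin(\theta_{lim}/2)/\kappa_{max}$; $y_\Omega=\int_0^{\kappa_{max}/\sigma_{max}}\sin(\sigma_{max}u^2/2)\,du+\cos(\theta_{lim}/2)/\kappa_{max}$; $R_T=\sqrt{x_\Omega^2+y_\Omega^2}$; $\gamma=\arctan(x_\Omega/y_\Omega)$;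 $R_M=R_T\cos\gamma$. $l_{min}$ is the smallest Euclidean distance between any two waypoints, start points or final points. Standing assumptions: $\theta_{lim}<\pi$ and $l_{min}>2R_T$. **Legs.** A leg goes from a start position $p^0$ with orientation $\theta^0$ to a goal $p^g$. If $p^g$ is on the left of the start configuration (the right case is its mirror image), it is a CC turn of angle $\beta$, starting at $(p^0,\theta^0)$, followed by a straight segment ending at $p^g$ and continuing in the end direction of the turn; $\beta\in[0,2\pi)$ is the angle for which $p^g$ lies on the forward ray from the end of the CC turn. The CC turn of angle $\beta$ has length $l^{cc}$ and curvature $\kappa(l)$, $l\in[0,l^{cc}]$: if $\beta\in[\theta_{lim},2\pi]$, $l^{cc}=\beta/\kappa_{max}+\kappa_{max}/\sigma_{max}$ and $\kappa(l)=\min(\sigma_{max}l,\kappa_{max},\sigma_{max}(l^{cc}-l))$; if $\beta\in(0,\theta_{lim})$, $l^{cc}=2\sqrt{\beta/\sigma_e}$ and $\kappa(l)=\sigma_e\min(l,l^{cc}-l)$, where $\sigma_e>0$ is such that the turn ends on the circle of radius $R_T$ through $p^0$ whose centre has coordinates $(x_\Omega,y_\Omega)$ in the start frame, i.e. $l^{cc}\int_0^1\cos(\tfrac{\beta}{2}(1-v^2))\,dv=2R_T\sin(\tfrac{\beta}{2}+\gamma)$. If $\beta=0$ the leg is a straight segment. **Constant $\mathcal{R}_{max}$.** With $\beta_{max}(l)=\pi+2\arctan\big(\frac{R_M}{l+R_T\sin\gamma}\big)$, $$\mathcal{R}_{max}=\frac{\sqrt{(l_{min}+R_T)^2-R_M^2}}{l_{min}}+\frac{\max\left(\frac{\beta_{max}(l_{min})}{\kappa_{max}}+\frac{\kappa_{max}}{\sigma_{max}},\frac{4.66R_T}{l_{min}}\right)+R_T}{l_{min}}.$$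 **Lower level graph $\Gamma_L(\boldsymbol{\xi}_i)$.** Fix glider $i$ and an allocation $\boldsymbol{\xi}_i\subseteq\{ip_1,\dots,ip_{n_{ip}}\}$. Nodes are visitation orders: finite sequences $\boldsymbol{\lambda}_i$ without repetition of elements of $\boldsymbol{\xi}_i\cup\{t_1,\dots,t_{n_t}\}\cup\{f\}$, where $f$ can only be last. The root is the empty sequence; a child of a node not ending in $f$ appends one new element. Goal nodes (set $\Phi^f_L$) are those ending in $f$. The composite path of $\boldsymbol{\lambda}_i$ is the concatenation of legs starting from $(p^0_i,\theta^0_i)$ through the waypoints in order (and to $p^f_i$ for $f$), each leg starting with the end orientation of the previous one. $S_L(\boldsymbol{\lambda}_i)$ is its total arclength. $K_L(\boldsymbol{\lambda}_i,\boldsymbol{\xi}_i)$ is the number of elements of $\boldsymbol{\xi}_i$ not in $\boldsymbol{\lambda}_i$. $P_L=(h^0_i+\sum_{k}h_{t_k}+1)/\tan\gamma_{d_{min}}$. Cost: $V_L(\boldsymbol{\lambda}_i,\boldsymbol{\xi}_i)=S_L(\boldsymbol{\lambda}_i)$ for non-goal nodes and $S_L(\boldsymbol{\lambda}_i)+K_L(\boldsymbol{\lambda}_i,\boldsymbol{\xi}_i)P_L$ for goal nodes. Weak cost $\underline{V}_L$: same formula with $S_L$ replaced by $S_L/\mathcal{R}_{max}$. $S^{max}_L(\boldsymbol{\lambda}_i)=(h^0_i+\sum_{k:\,t_k\in\boldsymbol{\lambda}_i}h_{t_k})/\tan\gamma_{d_{min}}$. Valid nodes $\Phi^v_L$: the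 root, and every node with $S_L<S^{max}_L$ whose parent is valid. Weakly valid nodes $\Phi^{wv}_L$: the root, and every node with $S_L/\mathcal{R}_{max}<S^{max}_L$ whose parent is weakly valid. **Upper level graph $\Gamma_U$.** Nodes are tuples $\boldsymbol{\Xi}=\{\boldsymbol{\xi}_i\}_{i=1}^{n_g}$ of pairwise disjoint sets of interest points ($\boldsymbol{\xi}_i$ allocated to glider $i$). The root has all $\boldsymbol{\xi}_i=\emptyset$. A child is obtained by adding one interest point not yet allocated to any glider to exactly one of the $\boldsymbol{\xi}_i$. For each $i$ let $\boldsymbol{\lambda}^{\boldsymbol{\xi}_i}_i$ be a minimizer of $V_L(\cdot,\boldsymbol{\xi}_i)$ over $\Phi^f_L\cap\Phi^v_L$ in $\Gamma_L(\boldsymbol{\xi}_i)$, and $\underline{\boldsymbol{\lambda}}_i$ a minimizer of $\underline{V}_L(\cdot,\boldsymbol{\xi}_i)$ over $\Phi^f_L\cap\Phi^{wv}_L$ (existence of these minimizers is assumed). Put $S_U(\boldsymbol{\xi}_i)=S_L(\boldsymbol{\lambda}^{\boldsymbol{\xi}_i}_i)$, $K_U(\boldsymbol{\xi}_i)=K_L(\boldsymbol{\lambda}^{\boldsymbol{\xi}_i}_i,\boldsymbol{\xi}_i)$, $\underline{V}_U(\boldsymbol{\xi}_i)=\underline{V}_L(\underline{\boldsymbol{\lambda}}_i,\boldsymbol{\xi}_i)$. Then $\mathbb{V}_U(\boldsymbol{\Xi})=\sum_{i}S_U(\boldsymbol{\xi}_i)+P_U\sum_iK_U(\boldsymbol{\xi}_i)$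 with $P_U=\big(\sum_{i=1}^{n_g}h^0_i+\sum_{k=1}^{n_t}h_{t_k}+1\big)/\tan\gamma_{d_{min}}$ (cost), and $\underline{\mathbb{V}}_U(\boldsymbol{\Xi})=\sum_i\underline{V}_U(\boldsymbol{\xi}_i)$ (weak cost). *)

(* Defs.v *)
(* Stdlib reals and Coquelicot integrals for the curves; MathComp finite types,
   sets and sequences for the graphs. *)
From Stdlib Require Import Reals ClassicalEpsilon Relation_Operators.
From mathcomp Require Import all_boot.
From Coquelicot Require Import Coquelicot.

Set Implicit Arguments.
Unset Strict Implicit.
Unset Printing Implicit Defensive.

Open Scope R_scope.

Definition point : Type := (R * R)%type.

Definition dist (p q : point) : R :=
  sqrt ((q.1 - p.1) ^ 2 + (q.2 - p.2) ^ 2).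

Record limits := Limits {
  kmax : R;  (* maximal curvature *)
  smax : R   (* maximal curvature rate (sharpness) *)
}.

Definition theta_lim (K : limits) : R := kmax K ^ 2 / smax K.

Definition x_Omega (K : limits) : R :=
  RInt (fun u => cos (smax K * u ^ 2 / 2)) 0 (kmax K / smax K)
  - sin (theta_lim K / 2) / kmax K.

Definition y_Omega (K : limits) : R :=
  RInt (fun u => sin (smax K * u ^ 2 / 2)) 0 (kmax K / smax K)
  + cos (theta_lim K / 2) / kmax K.

Definition R_T (K : limits) : R := sqrt (x_Omega K ^ 2 + y_Omega K ^ 2).

Definition gamma (K : limits) : R := atan (x_Omega K / y_Omega K).

Definition R_M (K : limits) : R := R_T K * cos (gamma K).

(* [s] is the sharpness of the CC turn of angle [b], for [0 < b < theta_lim]. *)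
Definition is_sharpness (K : limits) (b s : R) : Prop :=
  0 < s /\
  2 * sqrt (b / s) * RInt (fun v => cos (b / 2 * (1 - v ^ 2))) 0 1
  = 2 * R_T K * sin (b / 2 + gamma K).

Definition sharpness (K : limits) (b : R) : R :=
  epsilon (inhabits 0) (is_sharpness K b).

(* The turn of angle 0 is the empty curve, so that the leg is then a segment. *)
Definition turn_length (K : limits) (b : R) : R :=
  if Rle_dec (theta_lim K) b then b / kmax K + kmax K / smax K
  else if Rlt_dec 0 b then 2 * sqrt (b / sharpness K b)
  else 0.

Definition turn_curvature (K : limits) (b l : R) : R :=
  if Rle_dec (theta_lim K) b then
    Rmin (smax K * l) (Rmin (kmax K) (smax K * (turn_length K b - l)))
  else if Rlt_dec 0 b then sharpness K b * Rmin l (turn_length K b - l)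
  else 0.

(* The curve starting at [p] with orientation [th] whose signed curvature is
   [e * turn_curvature K b]: [e = 1] is a left turn and [e = -1] its mirror
   image in the line of the start heading. *)
Definition turn_heading (K : limits) (e b th l : R) : R :=
  th + RInt (fun u => e * turn_curvature K b u) 0 l.

Definition turn_position (K : limits) (e b : R) (p : point) (th l : R) : point :=
  (p.1 + RInt (fun u => cos (turn_heading K e b th u)) 0 l,
   p.2 + RInt (fun u => sin (turn_heading K e b th u)) 0 l).

Definition turn_end (K : limits) (e b : R) (p : point) (th : R) : point :=
  turn_position K e b p th (turn_length K b).

Definition turn_end_heading (K : limits) (e b th : R) : R :=
  turn_heading K e b th (turn_length K b).

(* Goals on the line of the start heading are treated as left goals. For a goal
   straight ahead the turn angle is 0; for a goal straight behind the left and
   right legs are mirror images of equal length. *)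
Definition leg_side (p : point) (th : R) (g : point) : R :=
  if Rle_dec 0 (cos th * (g.2 - p.2) - sin th * (g.1 - p.1)) then 1 else -1.

Definition is_turn_angle (K : limits) (p : point) (th : R) (g : point) (b : R)
    : Prop :=
  let e := leg_side p th g in
  0 <= b < 2 * PI /\
  exists2 s : R, 0 <= s &
    g = ((turn_end K e b p th).1 + s * cos (turn_end_heading K e b th),
         (turn_end K e b p th).2 + s * sin (turn_end_heading K e b th)).

(* For [theta_lim < PI] and [dist p g > 2 * R_T] such an angle exists and is
   unique, and so is the sharpness above. *)
Definition turn_angle (K : limits) (p : point) (th : R) (g : point) : R :=
  epsilon (inhabits 0) (is_turn_angle K p th g).

Definition leg_length (K : limits) (p : point) (th : R) (g : point) : R :=
  let e := leg_side p th g in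
  let b := turn_angle K p th g in
  turn_length K b + dist (turn_end K e b p th) g.

Definition leg_heading (K : limits) (p : point) (th : R) (g : point) : R :=
  turn_end_heading K (leg_side p th g) (turn_angle K p th g) th.

Fixpoint path_length (K : limits) (p : point) (th : R) (gs : seq point) : R :=
  match gs with
  | [::] => 0
  | g :: gs' => leg_length K p th g + path_length K g (leg_heading K p th g) gs'
  end.

Record scenario (ng nip nt : nat) := Scenario {
  lims : limits;
  gamma_d : R;                  (* descent angle *)
  ip_pos : 'I_nip -> point;     (* interest points *)
  th_pos : 'I_nt -> point;      (* thermals *)
  th_gain : 'I_nt -> R;         (* height gains of the thermals *)
  start_pos : 'I_ng -> point;
  start_heading : 'I_ng -> R;
  start_height : 'I_ng -> R;
  final_pos : 'I_ng -> point
}.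

Notation waypoint nip nt := ('I_nip + 'I_nt)%type.

(* [None] is the final position, called f in visitation orders. *)
Notation stop nip nt := (option (waypoint nip nt)).

Notation site ng nip nt := (waypoint nip nt + ('I_ng + 'I_ng))%type.

Section Scenario.
Context (ng nip nt : nat) (D : scenario ng nip nt).

Definition waypoint_pos (w : waypoint nip nt) : point :=
  match w with inl j => ip_pos D j | inr k => th_pos D k end.

Definition site_pos (a : site ng nip nt) : point :=
  match a with
  | inl w => waypoint_pos w
  | inr (inl i) => start_pos D i
  | inr (inr i) => final_pos D i
  end.

(* A minimum, since there are finitely many sites. *)
Definition l_min : R :=
  real (Glb_Rbar (fun d => exists a b : site ng nip nt,
    a != b /\ d = dist (site_pos a) (site_pos b))).

Definition beta_max (l : R) : R :=
  let K := lims D in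
  PI + 2 * atan (R_M K / (l + R_T K * sin (gamma K))).

Definition R_max : R :=
  let K := lims D in
  sqrt ((l_min + R_T K) ^ 2 - R_M K ^ 2) / l_min
  + (Rmax (beta_max l_min / kmax K + kmax K / smax K)
          (466 / 100 * R_T K / l_min) + R_T K) / l_min.

Definition standing_assumptions : Prop :=
  (0 < kmax (lims D) /\ 0 < smax (lims D)) /\
  0 < gamma_d D < PI / 2 /\
  (forall k, 0 < th_gain D k) /\
  (forall i, 0 < start_height D i) /\
  (forall i, - PI <= start_heading D i <= PI) /\
  theta_lim (lims D) < PI /\
  2 * R_T (lims D) < l_min.

Definition allowed (xi : {set 'I_nip}) (x : stop nip nt) : bool :=
  match x with Some (inl j) => j \in xi | _ => true end.

(* Visitation orders; the root is [::] and the parent of [rcons lam x] is [lam]. *)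
Definition lower_node (xi : {set 'I_nip}) (lam : seq (stop nip nt)) : bool :=
  [&& uniq lam, all (allowed xi) lam & None \notin take (size lam).-1 lam].

Definition goal (lam : seq (stop nip nt)) : bool :=
  (lam != [::]) && (last None lam == None).

Definition stop_pos (i : 'I_ng) (x : stop nip nt) : point :=
  match x with Some w => waypoint_pos w | None => final_pos D i end.

Definition S_L (i : 'I_ng) (lam : seq (stop nip nt)) : R :=
  path_length (lims D) (start_pos D i) (start_heading D i)
    [seq stop_pos i x | x <- lam].

Definition weak_S_L (i : 'I_ng) (lam : seq (stop nip nt)) : R :=
  S_L i lam / R_max.

Definition K_L (lam : seq (stop nip nt)) (xi : {set 'I_nip}) : nat :=
  #|[set j in xi | Some (inl j) \notin lam]|.

Definition P_L (i : 'I_ng) : R :=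
  (start_height D i + \big[Rplus/0]_(k < nt) th_gain D k + 1) / tan (gamma_d D).

Definition lower_cost (S : seq (stop nip nt) -> R) (i : 'I_ng)
    (xi : {set 'I_nip}) (lam : seq (stop nip nt)) : R :=
  if goal lam then S lam + INR (K_L lam xi) * P_L i else S lam.

Definition V_L (i : 'I_ng) := lower_cost (S_L i) i.
Definition weak_V_L (i : 'I_ng) := lower_cost (weak_S_L i) i.

Definition S_L_max (i : 'I_ng) (lam : seq (stop nip nt)) : R :=
  (start_height D i
   + \big[Rplus/0]_(k < nt | Some (inr k) \in lam) th_gain D k)
  / tan (gamma_d D).

Inductive lower_valid (S : seq (stop nip nt) -> R) (i : 'I_ng)
    (xi : {set 'I_nip}) : seq (stop nip nt) -> Prop :=
| lower_valid_root : lower_valid S i xi [::]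
| lower_valid_child lam x :
    lower_valid S i xi lam -> lower_node xi (rcons lam x) ->
    S (rcons lam x) < S_L_max i (rcons lam x) ->
    lower_valid S i xi (rcons lam x).

Definition valid (i : 'I_ng) := lower_valid (S_L i) i.
Definition weakly_valid (i : 'I_ng) := lower_valid (weak_S_L i) i.

Definition is_minimizer (T : Type) (V : T -> R) (Phi : T -> Prop) (x : T) : Prop :=
  Phi x /\ forall y, Phi y -> V x <= V y.

Definition optimal_order (i : 'I_ng) (xi : {set 'I_nip}) :=
  is_minimizer (V_L i xi) (fun mu => goal mu /\ valid i xi mu).

Definition weak_optimal_order (i : 'I_ng) (xi : {set 'I_nip}) :=
  is_minimizer (weak_V_L i xi) (fun mu => goal mu /\ weakly_valid i xi mu).

Definition upper_node (Xi : {ffun 'I_ng -> {set 'I_nip}}) : Prop :=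
  forall i i', i != i' -> [disjoint Xi i & Xi i'].

Definition upper_child (Xi Xi' : {ffun 'I_ng -> {set 'I_nip}}) : Prop :=
  exists (i : 'I_ng) (j : 'I_nip), (forall i', j \notin Xi i') /\
    Xi' = [ffun i' => if i' == i then j |: Xi i' else Xi i'].

(* [descendant Xi Xi']: [Xi'] is a proper descendant of [Xi]. *)
Definition descendant := clos_trans _ upper_child.

Definition P_U : R :=
  (\big[Rplus/0]_(i < ng) start_height D i
   + \big[Rplus/0]_(k < nt) th_gain D k + 1) / tan (gamma_d D).

(* In the upper level costs, [lam i xi] is the chosen optimal order, or weakly
   optimal order, of glider [i] for the allocation [xi]. *)
Section UpperCost.
Context (lam : 'I_ng -> {set 'I_nip} -> seq (stop nip nt)).

Definition S_U (i : 'I_ng) (xi : {set 'I_nip}) : R := S_L i (lam i xi).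
Definition K_U (i : 'I_ng) (xi : {set 'I_nip}) : nat := K_L (lam i xi) xi.
Definition weak_V_U (i : 'I_ng) (xi : {set 'I_nip}) : R :=
  weak_V_L i xi (lam i xi).

Definition upper_cost (Xi : {ffun 'I_ng -> {set 'I_nip}}) : R :=
  \big[Rplus/0]_(i < ng) S_U i (Xi i)
  + P_U * \big[Rplus/0]_(i < ng) INR (K_U i (Xi i)).

Definition weak_upper_cost (Xi : {ffun 'I_ng -> {set 'I_nip}}) : R :=
  \big[Rplus/0]_(i < ng) weak_V_U i (Xi i).

End UpperCost.
End Scenario.

(* Main.v *)
(* The weak cost divides path lengths by R_max, and a leg between distinct sites
   at distance l has length between l and R_max * l. Hence deleting stops from an
   order can raise its length at most by the factor R_max: by the triangle
   inequality it does not lengthen the polyline through the stops, which is a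
   lower bound for the length of the original path. Deleting the interest points
   outside Xi' i from the optimal order for Xi'' i keeps all thermals, so every
   prefix remains (weakly) valid, and it leaves no more points of Xi' i unvisited;
   so it competes in the weak minimization for Xi' i at no larger cost.

   For the upper bound on a leg, the turn of angle b ends on a circle of radius
   R_T about a centre Omega at distance R_T from the start, and the segment is
   tangent to the concentric circle of radius R_M, so that its length is
   sqrt (|g - Omega|^2 - R_M^2) - R_T sin gamma with |g - Omega| <= l + R_T.
   The turn has b <= beta_max l; if b >= theta_lim its length is explicit, and if
   b < theta_lim it exceeds (PI + theta_lim) / kmax by at most R_T, which is the
   slack available in R_max. *)
From Stdlib Require Import Reals Lra Psatz ClassicalEpsilon.
From mathcomp Require Import all_boot.
From Coquelicot Require Import Coquelicot.
Require Import Defs.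

Set Implicit Arguments.
Unset Strict Implicit.
Unset Printing Implicit Defensive.

Local Open Scope R_scope.

(* [field] and [lra] fail on equalities typed in a Coquelicot structure on [R]. *)
Ltac asR := match goal with |- @eq _ ?a ?b => change (@eq R a b) end.

Ltac cont_smooth :=
  intros; apply: (ex_derive_continuous (V := R_NormedModule)); auto_derive.

(** * Integrals of continuous functions and curves of symmetric curvature *)

Lemma ex_RInt_cont (f : R -> R) (a b : R) :
  (forall x, continuous f x) -> ex_RInt f a b.
Proof. by move=> cf; apply: ex_RInt_continuous => z _; apply: cf. Qed.

Lemma RInt_antiderivative (F f : R -> R) (a b : R) :
  (forall x, is_derive F x (f x)) -> (forall x, continuous f x) ->
  RInt f a b = F b - F a.
Proof.
move=> dF cf; apply: is_RInt_unique.
by apply: (is_RInt_derive F) => x _; [apply: dF | apply: cf].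
Qed.

Lemma continuous_Rmin (f g : R -> R) (x : R) :
  continuous f x -> continuous g x ->
  continuous (fun u => Rmin (f u) (g u)) x.
Proof.
move=> cf cg.
apply: (continuous_ext (fun u => / 2 * (f u + g u - Rabs (f u - g u)))).
  by move=> u; rewrite /Rmin; case: Rle_dec => h;
    [rewrite Rabs_left1 | rewrite Rabs_right]; lra.
apply: (continuous_mult (K := R_AbsRing)); first exact: continuous_const.
apply: (continuous_minus (V := R_NormedModule)).
  exact: (continuous_plus (V := R_NormedModule)).
apply: continuous_Rabs_comp.
exact: (continuous_minus (V := R_NormedModule)).
Qed.

Lemma continuous_RInt0 (k : R -> R) (x : R) :
  (forall u, continuous k u) -> continuous (fun u => RInt k 0 u) x.
Proof.
move=> ck; apply: (ex_derive_continuous (V := R_NormedModule)).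
exists (k x); apply: (is_derive_RInt k (fun u => RInt k 0 u) 0) => //.
apply: filter_forall => u; apply: RInt_correct; exact: ex_RInt_cont.
Qed.

Lemma continuous_affine (c d x : R) : continuous (fun u : R => c + d * u) x.
Proof. by apply: ex_derive_continuous; auto_derive. Qed.

Lemma continuous_cos_affine (h : R -> R) (c d x : R) :
  continuous h x -> continuous (fun u => cos (c + d * h u)) x.
Proof.
move=> ch; apply: continuous_cos_comp.
apply: (continuous_comp h (fun v => c + d * v)) => //.
exact: continuous_affine.
Qed.

Lemma RInt_reflect (f : R -> R) (T a b : R) :
  (forall u, continuous f u) ->
  RInt (fun u => f (T - u)) a b = RInt f (T - b) (T - a).
Proof.
move=> cf.
have E (u : R) : -1 * u + T = T - u by ring.
have := @RInt_comp_lin R_CompleteNormedModule f (-1) T a b (ex_RInt_cont _ _ cf).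
rewrite !E => H.
rewrite -[RHS]opp_RInt_swap; last exact: ex_RInt_cont.
rewrite -H -[RHS]RInt_opp.
  apply: RInt_ext => u _; rewrite /opp /= /scal /= /mult /= E; lra.
apply: ex_RInt_cont => u.
apply: (continuous_mult (K := R_AbsRing)); first exact: continuous_const.
apply: continuous_comp; last exact: cf.
by apply: (ex_derive_continuous (V := R_NormedModule)); auto_derive.
Qed.

Lemma RInt_Chasles_cont (f : R -> R) (a b c : R) :
  (forall u, continuous f u) -> RInt f a b + RInt f b c = RInt f a c.
Proof. by move=> cf; apply: RInt_Chasles; apply: ex_RInt_cont. Qed.

(** For a curvature [k] symmetric about the midpoint, the last stretch of length [u] turns by as
    much as the first one. *)
Lemma RInt_reflect_sym (k : R -> R) (T u : R) :
  (forall u, continuous k u) -> (forall u, k (T - u) = k u) ->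
  RInt k 0 (T - u) = RInt k 0 T - RInt k 0 u.
Proof.
move=> ck ks.
have <- := RInt_Chasles_cont 0 (T - u) T ck.
have -> : RInt k 0 u = RInt (fun u => k (T - u)) 0 u.
  by apply: RInt_ext => v _; rewrite ks.
rewrite RInt_reflect // Rminus_0_r. lra.
Qed.

Lemma RInt_fold_half (f : R -> R) (T : R) :
  (forall u, continuous f u) ->
  RInt f 0 T = RInt (fun u => f u + f (T - u)) 0 (T / 2).
Proof.
move=> cf.
rewrite (RInt_plus (V := R_CompleteNormedModule)) ?RInt_reflect //.
- have -> : T - T / 2 = T / 2 by field.
  by rewrite Rminus_0_r /plus /= RInt_Chasles_cont.
- exact: ex_RInt_cont.
- apply: ex_RInt_cont => u; apply: continuous_comp; last exact: cf.
  by apply: (ex_derive_continuous (V := R_NormedModule)); auto_derive.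
Qed.

(* The deviation from the mean heading [th + e * B / 2] is odd about the
   midpoint, so the curve ends in the direction of the mean heading. *)
Lemma RInt_cos_symmetric_heading (k : R -> R) (T th e : R) :
  let B := RInt k 0 T in
  (forall u, continuous k u) -> (forall u, k (T - u) = k u) ->
  e = 1 \/ e = -1 ->
  RInt (fun u => cos (th + e * RInt k 0 u)) 0 T
  = 2 * RInt (fun u => cos (RInt k 0 u - B / 2)) 0 (T / 2)
    * cos (th + e * (B / 2)).
Proof.
move=> B ck ks he.
rewrite RInt_fold_half; last first.
  by move=> u; apply: continuous_cos_affine; apply: continuous_RInt0.
rewrite [RHS](_ : _ = 2 * cos (th + e * (B / 2))
    * RInt (fun u => cos (RInt k 0 u - B / 2)) 0 (T / 2)); last by lra.
rewrite -[RHS](RInt_scal (V := R_CompleteNormedModule)); last first.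
  apply: ex_RInt_cont => u.
  apply: (continuous_ext (fun u => cos (- (B / 2) + 1 * RInt k 0 u))).
    by move=> v; congr cos; ring.
  by apply: continuous_cos_affine; apply: continuous_RInt0.
apply: RInt_ext => u _.
(* [form1] turns the sum of two cosines into a product: the half-difference is the deviation up to
   the sign [e], the half-sum is the mean heading. *)
rewrite RInt_reflect_sym // -/B /scal /= /mult /= form1.
have -> : (th + e * RInt k 0 u - (th + e * (B - RInt k 0 u))) / 2
          = e * (RInt k 0 u - B / 2) by field.
have -> : (th + e * RInt k 0 u + (th + e * (B - RInt k 0 u))) / 2
          = th + e * (B / 2) by field.
have -> : cos (e * (RInt k 0 u - B / 2)) = cos (RInt k 0 u - B / 2).
  case: he => ->; first by rewrite Rmult_1_l.
  by rewrite -cos_neg; congr cos; ring.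
asR; ring.
Qed.

Lemma RInt_Rminus (f g : R -> R) (a b : R) :
  (forall x, continuous f x) -> (forall x, continuous g x) ->
  RInt (fun x => f x - g x) a b = RInt f a b - RInt g a b.
Proof.
by move=> cf cg; apply: (RInt_minus (V := R_CompleteNormedModule));
  apply: ex_RInt_cont.
Qed.

Lemma RInt_Rscal (f : R -> R) (c a b : R) :
  (forall x, continuous f x) -> RInt (fun x => c * f x) a b = c * RInt f a b.
Proof.
by move=> cf; apply: (RInt_scal (V := R_CompleteNormedModule)); apply: ex_RInt_cont.
Qed.

(** * The clothoid constants *)

Definition admissible (K : limits) : Prop :=
  0 < kmax K /\ 0 < smax K /\ theta_lim K < PI.

Section Clothoid.
Variable K : limits.
Hypothesis hK : admissible K.

Let k0 : 0 < kmax K. Proof. by case: hK. Qed.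
Let s0 : 0 < smax K. Proof. by case: hK => _ []. Qed.
Let thpi : theta_lim K < PI. Proof. by case: hK => _ []. Qed.
Let L0 : 0 < kmax K / smax K. Proof. exact: Rdiv_lt_0_compat. Qed.

Lemma theta_lim_gt0 : 0 < theta_lim K.
Proof. by apply: Rdiv_lt_0_compat => //; nra. Qed.

Lemma theta_lim_half : smax K * (kmax K / smax K) ^ 2 / 2 = theta_lim K / 2.
Proof. rewrite /theta_lim; field; lra. Qed.

(* Integration by parts against the tangent angle [smax * u ^ 2 / 2]. *)
Lemma x_OmegaE :
  x_Omega K = RInt (fun u => (1 - u * (smax K / kmax K))
                             * cos (smax K * u ^ 2 / 2)) 0 (kmax K / smax K).
Proof.
have E : RInt (fun u => u * (smax K / kmax K) * cos (smax K * u ^ 2 / 2))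
    0 (kmax K / smax K) = sin (theta_lim K / 2) / kmax K.
  rewrite (RInt_antiderivative (F := fun u => sin (smax K * u ^ 2 / 2) / kmax K)).
  - rewrite theta_lim_half (_ : smax K * 0 ^ 2 / 2 = 0) ?sin_0; last by field.
    asR; field; lra.
  - move=> u; auto_derive; [by [] | rewrite /= /Rdiv; asR; field; lra].
  - by cont_smooth.
rewrite (RInt_ext _ (fun u => cos (smax K * u ^ 2 / 2)
   - u * (smax K / kmax K) * cos (smax K * u ^ 2 / 2))); last by move=> u _; asR; lra.
rewrite RInt_Rminus ?E /x_Omega; try by cont_smooth.
by asR; lra.
Qed.

(** Here the boundary term at 0 leaves [/ kmax K]. As in [x_OmegaE], the weight
    [1 - u * (smax K / kmax K)] is positive inside the ramp, so bounds on the sine or cosine carry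
    over to the constant. *)
Lemma y_OmegaE :
  y_Omega K = / kmax K + RInt (fun u => (1 - u * (smax K / kmax K))
                             * sin (smax K * u ^ 2 / 2)) 0 (kmax K / smax K).
Proof.
have E : RInt (fun u => u * (smax K / kmax K) * sin (smax K * u ^ 2 / 2))
    0 (kmax K / smax K) = / kmax K - cos (theta_lim K / 2) / kmax K.
  rewrite (RInt_antiderivative (F := fun u => - cos (smax K * u ^ 2 / 2) / kmax K)).
  - rewrite theta_lim_half (_ : smax K * 0 ^ 2 / 2 = 0) ?cos_0; last by field.
    by asR; field; lra.
  - move=> u; auto_derive; [by [] | rewrite /= /Rdiv; asR; field; lra].
  - by cont_smooth.
rewrite (RInt_ext _ (fun u => sin (smax K * u ^ 2 / 2)
   - u * (smax K / kmax K) * sin (smax K * u ^ 2 / 2))); last by move=> u _; asR; lra.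
rewrite RInt_Rminus ?E /y_Omega; try by cont_smooth.
by asR; lra.
Qed.

(** The tangent angle grows along the ramp up to [theta_lim K / 2], which [theta_lim K < PI] keeps
    acute. *)
Let arc_angle u : 0 < u < kmax K / smax K ->
  0 < u * (smax K / kmax K) < 1 /\ 0 < smax K * u ^ 2 / 2 < PI / 2.
Proof.
move=> [u0 uL]; have skk : smax K / kmax K * (kmax K / smax K) = 1 by asR; field; lra.
have sk0 : 0 < smax K / kmax K by apply: Rdiv_lt_0_compat.
have th := theta_lim_half; have thp := thpi; have s00 := s0.
split; first by nra.
have uu : u ^ 2 < (kmax K / smax K) ^ 2 by nra.
have := Rmult_lt_compat_l _ _ _ s00 uu.
have : 0 < smax K * u ^ 2 by apply: Rmult_lt_0_compat; nra.
move=> ? ?; split; lra.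
Qed.

Lemma x_Omega_gt0 : 0 < x_Omega K.
Proof.
rewrite x_OmegaE; apply: RInt_gt_0 => //; last by cont_smooth.
move=> u hu; have [h1 h2] := arc_angle hu.
by apply: Rmult_lt_0_compat; [lra | apply: cos_gt_0; lra].
Qed.

(** Bounding the cosine by 1 leaves the area of a triangle of height 1 over the ramp. *)
Lemma x_Omega_le : x_Omega K <= theta_lim K / 2 / kmax K.
Proof.
rewrite x_OmegaE.
have -> : theta_lim K / 2 / kmax K
    = RInt (fun u => 1 - u * (smax K / kmax K)) 0 (kmax K / smax K).
  rewrite (RInt_antiderivative (F := fun u => u - u ^ 2 / 2 * (smax K / kmax K))).
  - rewrite /theta_lim; asR; field; lra.
  - move=> u; auto_derive; [by [] | rewrite /= /Rdiv; asR; field; lra].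
  - by cont_smooth.
apply: RInt_le; first lra; try by apply: ex_RInt_cont; cont_smooth.
move=> u hu; have [h1 h2] := arc_angle hu.
by have := COS_bound (smax K * u ^ 2 / 2); nra.
Qed.

Lemma y_Omega_ge : / kmax K <= y_Omega K.
Proof.
rewrite y_OmegaE.
rewrite -[X in X <= _]Rplus_0_r; apply: Rplus_le_compat_l.
apply: RInt_ge_0; first lra; first by apply: ex_RInt_cont; cont_smooth.
move=> u hu; have [h1 h2] := arc_angle hu.
apply: Rmult_le_pos; first lra.
by apply: sin_ge_0; move: PI_RGT_0; lra.
Qed.

(** Bounding the sine by its argument leaves a cubic polynomial to integrate. *)
Lemma y_Omega_le : y_Omega K <= (1 + theta_lim K ^ 2 / 24) / kmax K.
Proof.
rewrite y_OmegaE.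
have -> : (1 + theta_lim K ^ 2 / 24) / kmax K
    = / kmax K + RInt (fun u => (1 - u * (smax K / kmax K))
                                * (smax K * u ^ 2 / 2)) 0 (kmax K / smax K).
  rewrite (RInt_antiderivative
    (F := fun u => smax K * (u ^ 3 / 6 - u ^ 4 / 8 * (smax K / kmax K)))).
  - rewrite /theta_lim; asR; field; lra.
  - move=> u; auto_derive; [by [] | rewrite /= /Rdiv; asR; field; lra].
  - by cont_smooth.
apply: Rplus_le_compat_l.
apply: RInt_le; first lra; try by apply: ex_RInt_cont; cont_smooth.
move=> u hu; have [h1 h2] := arc_angle hu.
by have := sin_lt_x _ (proj1 h2); nra.
Qed.

Lemma y_Omega_gt0 : 0 < y_Omega K.
Proof. by have := y_Omega_ge; have := Rinv_0_lt_compat _ k0; lra. Qed.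

Lemma R_T_sqr : R_T K ^ 2 = x_Omega K ^ 2 + y_Omega K ^ 2.
Proof. by rewrite /R_T pow2_sqrt //; nra. Qed.

Lemma R_T_ge_y : y_Omega K <= R_T K.
Proof.
rewrite -[y_Omega K]sqrt_pow2; last by have := y_Omega_gt0; lra.
by apply: sqrt_le_1_alt; nra.
Qed.

Lemma R_T_gt0 : 0 < R_T K.
Proof. by have := R_T_ge_y; have := y_Omega_gt0; lra. Qed.

Let sqrt_R_T : sqrt (1 + Rsqr (x_Omega K / y_Omega K)) = R_T K / y_Omega K.
Proof.
have y0 := y_Omega_gt0; have T0 := R_T_gt0.
rewrite -[RHS]sqrt_pow2; last by apply: Rlt_le; apply: Rdiv_lt_0_compat.
congr sqrt; rewrite /Rsqr.
rewrite (_ : (R_T K / y_Omega K) ^ 2 = R_T K ^ 2 / y_Omega K ^ 2); last by asR; field; lra.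
by rewrite R_T_sqr; field; lra.
Qed.

(** In the right triangle with legs [x_Omega K], [y_Omega K] and hypotenuse [R_T K], [gamma K] is
    the angle opposite to [x_Omega K]. From here on the trigonometric constants are replaced by the
    coordinates of the centre. *)
Lemma R_M_y : R_M K = y_Omega K.
Proof.
have y0 := y_Omega_gt0; have T0 := R_T_gt0.
by rewrite /R_M /gamma cos_atan sqrt_R_T; field; lra.
Qed.

Lemma R_T_sin_gamma : R_T K * sin (gamma K) = x_Omega K.
Proof.
have y0 := y_Omega_gt0; have T0 := R_T_gt0.
by rewrite /gamma sin_atan sqrt_R_T; field; lra.
Qed.

(** This is half the chord of a CC turn of angle [2 * a]. *)
Lemma R_T_sin_add (a : R) :
  R_T K * sin (a + gamma K) = x_Omega K * cos a + y_Omega K * sin a.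
Proof. by rewrite sin_plus -R_M_y -R_T_sin_gamma /R_M; ring. Qed.

End Clothoid.

(** * The CC turn *)

Section Turn.
Variable K : limits.
Hypothesis hK : admissible K.

Let k0 : 0 < kmax K. Proof. by case: hK. Qed.
Let s0 : 0 < smax K. Proof. by case: hK => _ []. Qed.
Let thpi : theta_lim K < PI. Proof. by case: hK => _ []. Qed.

Let L0 : 0 < kmax K / smax K. Proof. exact: Rdiv_lt_0_compat. Qed.

Lemma turn_length_long (b : R) : theta_lim K <= b ->
  turn_length K b = b / kmax K + kmax K / smax K.
Proof. by move=> h; rewrite /turn_length; case: (Rle_dec (theta_lim K) b) => [|hn] /=; lra. Qed.

Lemma turn_length_short (b : R) : 0 < b < theta_lim K ->
  turn_length K b = 2 * sqrt (b / sharpness K b).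
Proof.
move=> [b0 bt]; rewrite /turn_length; case: (Rle_dec (theta_lim K) b) => [|hn] /=; first lra.
by case: (Rlt_dec 0 b) => /=; lra.
Qed.

Lemma turn_curvature_long (b u : R) : theta_lim K <= b ->
  turn_curvature K b u =
  Rmin (smax K * u) (Rmin (kmax K) (smax K * (turn_length K b - u))).
Proof. by move=> h; rewrite /turn_curvature; case: (Rle_dec (theta_lim K) b) => [|hn] /=; lra. Qed.

Lemma turn_curvature_short (b u : R) : 0 < b < theta_lim K ->
  turn_curvature K b u = sharpness K b * Rmin u (turn_length K b - u).
Proof.
move=> [b0 bt]; rewrite /turn_curvature; case: (Rle_dec (theta_lim K) b) => [|hn] /=; first lra.
by case: (Rlt_dec 0 b) => /=; lra.
Qed.

Lemma turn_length_ge0 (b : R) : 0 <= turn_length K b.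
Proof.
case: (Rle_dec (theta_lim K) b) => h1.
  have th0 := theta_lim_gt0 hK; have l0 := L0; rewrite turn_length_long //.
  have ? : 0 < b / kmax K by apply: Rdiv_lt_0_compat => //; lra.
  lra.
rewrite /turn_length; case: (Rle_dec (theta_lim K) b) => [|hn] /=; first lra.
by case: (Rlt_dec 0 b) => h2 /=; last lra; have := sqrt_pos (b / sharpness K b); lra.
Qed.

Lemma turn_curvature_continuous (b x : R) : continuous (turn_curvature K b) x.
Proof.
rewrite /turn_curvature; case: (Rle_dec (theta_lim K) b) => h1 /=.
  apply: continuous_Rmin; first by cont_smooth.
  by apply: continuous_Rmin; cont_smooth.
case: (Rlt_dec 0 b) => h2 /=; last exact: continuous_const.
apply: (continuous_mult (K := R_AbsRing)); first exact: continuous_const.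
by apply: continuous_Rmin; cont_smooth.
Qed.

Lemma turn_curvature_sym (b u : R) :
  turn_curvature K b (turn_length K b - u) = turn_curvature K b u.
Proof.
rewrite /turn_curvature.
have -> : turn_length K b - (turn_length K b - u) = u by ring.
case: (Rle_dec (theta_lim K) b) => h1 /=.
  by rewrite Rmin_assoc Rmin_comm (Rmin_comm _ (kmax K)).
by case: (Rlt_dec 0 b) => h2 //=; rewrite Rmin_comm.
Qed.

Lemma sharpness_integral_gt0 (b : R) : 0 <= b < theta_lim K ->
  0 < RInt (fun v => cos (b / 2 * (1 - v ^ 2))) 0 1.
Proof.
move=> [b0 bt]; apply: RInt_gt_0; first lra; last by cont_smooth.
have thp := thpi; move=> v hv.
have v2 : 0 < 1 - v ^ 2 < 1 by nra.
have : 0 <= b / 2 * (1 - v ^ 2) <= b / 2 by nra.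
by move=> [h1 h2]; apply: cos_gt_0; lra.
Qed.

Lemma sharpnessP (b : R) : 0 < b < theta_lim K ->
  is_sharpness K b (sharpness K b).
Proof.
move=> [b0 bt]; apply: epsilon_spec.
have I0 : 0 < RInt (fun v => cos (b / 2 * (1 - v ^ 2))) 0 1.
  by apply: sharpness_integral_gt0; lra.
set I := RInt _ _ _ in I0.
(* The defining equation reads [sqrt (b / s) = c], which is solved by [s = b / c ^ 2]. *)
pose c := R_T K * sin (b / 2 + gamma K) / I.
have c0 : 0 < c.
  apply: Rdiv_lt_0_compat => //; rewrite R_T_sin_add //.
  have : 0 < cos (b / 2) by apply: cos_gt_0; move: thpi; lra.
  have : 0 < sin (b / 2) by apply: sin_gt_0; move: thpi; lra.
  by have := x_Omega_gt0 hK; have := y_Omega_gt0 hK; nra.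
exists (b / c ^ 2); split; first by apply: Rdiv_lt_0_compat => //; nra.
have -> : b / (b / c ^ 2) = c ^ 2 by field; lra.
by rewrite sqrt_pow2 -/I; [rewrite /c; asR; field | ]; lra.
Qed.

(** A ramp has length [kmax K / smax K = theta_lim K / kmax K <= b / kmax K], so the opening and the
    closing ramp do not overlap. *)
Lemma turn_length_long_ge (b : R) : theta_lim K <= b ->
  2 * (kmax K / smax K) <= turn_length K b.
Proof.
move=> hb; have k00 := k0; have s00 := s0; rewrite turn_length_long //.
have E : kmax K / smax K = theta_lim K / kmax K.
  by rewrite /theta_lim; field; lra.
have := Rmult_le_compat_r _ _ _ (Rlt_le _ _ (Rinv_0_lt_compat _ k00)) hb.
by rewrite {1}E -!/(Rdiv _ _); lra.
Qed.

Let ramp (f : R -> R) (s w : R) : 0 <= w ->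
  (forall v, 0 < v < w -> f v = s * v) -> RInt f 0 w = s * w ^ 2 / 2.
Proof.
move=> w0 E; rewrite (RInt_ext _ (fun v => s * v)).
  rewrite (RInt_antiderivative (F := fun v => s * v ^ 2 / 2)).
  - by asR; field.
  - by move=> v; auto_derive; [by [] | asR; field].
  - by cont_smooth.
by rewrite Rmin_left // Rmax_right.
Qed.

Lemma turn_heading_short (b u : R) : 0 < b < theta_lim K ->
  0 <= u <= turn_length K b / 2 ->
  RInt (turn_curvature K b) 0 u = sharpness K b * u ^ 2 / 2.
Proof.
move=> hb [u0 uT]; apply: ramp => // v hv.
by rewrite turn_curvature_short // Rmin_left //; lra.
Qed.

Let sL : smax K * (kmax K / smax K) = kmax K.
Proof. by have s00 := s0; field; lra. Qed.

(** Before the midpoint at least one ramp length remains, so the closing ramp is not below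
    [kmax K]. *)
Let curvature_first_half (b v : R) : theta_lim K <= b ->
  0 < v < turn_length K b / 2 ->
  turn_curvature K b v = Rmin (smax K * v) (kmax K).
Proof.
move=> hb hv; have hT := turn_length_long_ge hb; have s00 := s0.
rewrite turn_curvature_long // (Rmin_left (kmax K)) // -sL.
by apply: Rmult_le_compat_l; lra.
Qed.

Lemma turn_heading_ramp (b u : R) : theta_lim K <= b ->
  0 <= u <= kmax K / smax K ->
  RInt (turn_curvature K b) 0 u = smax K * u ^ 2 / 2.
Proof.
move=> hb hu; have hT := turn_length_long_ge hb; have s00 := s0.
apply: ramp => [|w hw]; first lra.
rewrite curvature_first_half //; last lra.
by rewrite Rmin_left // -sL; nra.
Qed.

Lemma turn_heading_plateau (b u : R) : theta_lim K <= b ->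
  kmax K / smax K <= u <= turn_length K b / 2 ->
  RInt (turn_curvature K b) 0 u
  = theta_lim K / 2 + kmax K * (u - kmax K / smax K).
Proof.
move=> hb hu; have s00 := s0; have l0 := L0.
rewrite -(RInt_Chasles_cont 0 (kmax K / smax K) u); last first.
  exact: turn_curvature_continuous.
rewrite turn_heading_ramp // ?theta_lim_half //; last lra.
congr (_ + _); rewrite (RInt_ext _ (fun=> kmax K)).
  by rewrite RInt_const /scal /= /mult /=; asR; ring.
rewrite Rmin_left ?Rmax_right; [|lra..].
move=> v hv; rewrite curvature_first_half //; last lra.
by rewrite Rmin_right // -sL; nra.
Qed.

(** By symmetry it is enough that the first half turns by [b / 2]. For a short turn its curvature
    graph is a triangle of base [sqrt (b / sharpness K b)] and slope [sharpness K b]. *)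
Lemma turn_angle_total (b : R) : 0 < b ->
  RInt (turn_curvature K b) 0 (turn_length K b) = b.
Proof.
move=> b0; have s00 := s0; have k00 := k0; have T0 := turn_length_ge0 b.
have := RInt_reflect_sym (turn_length K b / 2) (@turn_curvature_continuous b)
  (turn_curvature_sym b).
have -> : turn_length K b - turn_length K b / 2 = turn_length K b / 2 by field.
suff -> : RInt (turn_curvature K b) 0 (turn_length K b / 2) = b / 2.
  by move=> E; asR; lra.
case: (Rle_dec (theta_lim K) b) => hb.
  have hT := turn_length_long_ge hb.
  rewrite turn_heading_plateau //; last lra.
  by rewrite turn_length_long // /theta_lim; asR; field; lra.
have hb' : 0 < b < theta_lim K by lra.
have [sp _] := sharpnessP hb'.
rewrite turn_heading_short //; last lra.
rewrite turn_length_short //.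
have -> : 2 * sqrt (b / sharpness K b) / 2 = sqrt (b / sharpness K b) by field.
rewrite pow2_sqrt; last by apply: Rlt_le; apply: Rdiv_lt_0_compat.
by asR; field; lra.
Qed.

(** The ramp contributes the integrals in [x_Omega] and [y_Omega]. The circular arc, on which the
    deviation from the mean heading rises to 0 at the midpoint, contributes their terms in
    [theta_lim K / 2]. *)
Lemma turn_chord_long (b : R) : theta_lim K <= b ->
  RInt (fun u => cos (RInt (turn_curvature K b) 0 u - b / 2)) 0 (turn_length K b / 2)
  = x_Omega K * cos (b / 2) + y_Omega K * sin (b / 2).
Proof.
move=> hb; have s00 := s0; have k00 := k0; have l0 := L0.
have hT := turn_length_long_ge hb.
set T2 := turn_length K b / 2.
rewrite -(RInt_Chasles_cont 0 (kmax K / smax K) T2); last first.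
  move=> u; apply: (continuous_ext
    (fun u => cos (- (b / 2) + 1 * RInt (turn_curvature K b) 0 u))).
    by move=> v; congr cos; ring.
  by apply: continuous_cos_affine; apply: continuous_RInt0; apply: turn_curvature_continuous.
rewrite (RInt_ext _ (fun u => cos (b / 2) * cos (smax K * u ^ 2 / 2)
    - (- sin (b / 2)) * sin (smax K * u ^ 2 / 2)) 0); last first.
  rewrite Rmin_left ?Rmax_right; [|lra..].
  move=> u hu; rewrite turn_heading_ramp //; last lra.
  by rewrite cos_minus; asR; ring.
rewrite RInt_Rminus; try by cont_smooth.
rewrite RInt_Rscal; last by cont_smooth.
rewrite RInt_Rscal; last by cont_smooth.
rewrite (RInt_ext _ (fun u => cos (theta_lim K / 2 + kmax K * (u - kmax K / smax K) - b / 2))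
  (kmax K / smax K)); last first.
  rewrite /T2 Rmin_left ?Rmax_right; [|lra..].
  by move=> u hu; rewrite turn_heading_plateau //; lra.
have -> : RInt (fun u => cos (theta_lim K / 2 + kmax K * (u - kmax K / smax K) - b / 2))
    (kmax K / smax K) T2 = - sin (theta_lim K / 2 - b / 2) / kmax K.
  rewrite (RInt_antiderivative
    (F := fun u => sin (theta_lim K / 2 + kmax K * (u - kmax K / smax K) - b / 2) / kmax K)).
  - have -> : theta_lim K / 2 + kmax K * (T2 - kmax K / smax K) - b / 2 = 0.
      by rewrite /T2 turn_length_long // /theta_lim; field; lra.
    have -> : theta_lim K / 2 + kmax K * (kmax K / smax K - kmax K / smax K) - b / 2
      = theta_lim K / 2 - b / 2 by ring.
    by rewrite sin_0; asR; field; lra.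
  - by move=> u; auto_derive; [by [] | rewrite /= /Rdiv /Rminus; asR; field; lra].
  - by cont_smooth.
by rewrite sin_minus /x_Omega /y_Omega; asR; field; lra.
Qed.

(** Rescaling the half turn to the unit interval yields the integral in [is_sharpness], whose
    equation then gives the chord. *)
Lemma turn_chord_short (b : R) : 0 < b < theta_lim K ->
  RInt (fun u => cos (RInt (turn_curvature K b) 0 u - b / 2)) 0 (turn_length K b / 2)
  = x_Omega K * cos (b / 2) + y_Omega K * sin (b / 2).
Proof.
move=> hb; have T0 := turn_length_ge0 b.
have [sp E] := sharpnessP hb.
have T2E : turn_length K b / 2 = sqrt (b / sharpness K b).
  by rewrite turn_length_short //; field.
rewrite (RInt_ext _ (fun u => cos (sharpness K b * u ^ 2 / 2 - b / 2))); last first.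
  rewrite Rmin_left ?Rmax_right; [|lra..].
  by move=> u hu; rewrite turn_heading_short //; lra.
set r := turn_length K b / 2 in T2E *.
have := @RInt_comp_lin R_CompleteNormedModule
  (fun u => cos (sharpness K b * u ^ 2 / 2 - b / 2)) r 0 0 1.
have -> : r * 0 + 0 = 0 by ring.
have -> : r * 1 + 0 = r by ring.
move=> <-; last by apply: ex_RInt_cont; cont_smooth.
rewrite -R_T_sin_add //; apply: (Rmult_eq_reg_l 2); last lra.
rewrite -[RHS]Rmult_assoc -E -T2E.
rewrite RInt_Rscal; last by cont_smooth.
rewrite [RHS]Rmult_assoc; congr (_ * (_ * _)).
apply: RInt_ext => v _; rewrite -cos_neg; congr cos.
have r2 : r ^ 2 = b / sharpness K b.
  by rewrite T2E pow2_sqrt //; apply: Rlt_le; apply: Rdiv_lt_0_compat; lra.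
have -> : sharpness K b * (r * v + 0) ^ 2 / 2
   = sharpness K b * r ^ 2 * v ^ 2 / 2 by field.
by rewrite r2; field; lra.
Qed.

Lemma turn_chord (b : R) : 0 < b ->
  RInt (fun u => cos (RInt (turn_curvature K b) 0 u - b / 2)) 0 (turn_length K b / 2)
  = x_Omega K * cos (b / 2) + y_Omega K * sin (b / 2).
Proof.
move=> b0; case: (Rle_dec (theta_lim K) b) => hb; first exact: turn_chord_long.
by apply: turn_chord_short; lra.
Qed.

(** The chord [c] in the direction [b / 2] is the polar equation of the circle through the start
    about the centre [(x_Omega K, y_Omega K)]. *)
Lemma turn_endE (b e : R) (p : point) (th : R) : 0 < b -> e = 1 \/ e = -1 ->
  let c := 2 * (x_Omega K * cos (b / 2) + y_Omega K * sin (b / 2)) in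
  turn_end K e b p th = (p.1 + c * cos (th + e * (b / 2)),
                         p.2 + c * sin (th + e * (b / 2))).
Proof.
move=> b0 he c.
have ck := @turn_curvature_continuous b.
have hE u ph : ph + RInt (fun u => e * turn_curvature K b u) 0 u
    = ph + e * RInt (turn_curvature K b) 0 u.
  by rewrite RInt_Rscal.
have H ph : RInt (fun u => cos (ph + RInt (fun u => e * turn_curvature K b u) 0 u)) 0
    (turn_length K b) = c * cos (ph + e * (b / 2)).
  rewrite (RInt_ext _ (fun u => cos (ph + e * RInt (turn_curvature K b) 0 u))).
    rewrite RInt_cos_symmetric_heading ?turn_angle_total ?turn_chord //.
    exact: turn_curvature_sym.
  by move=> u _; rewrite hE.
rewrite /turn_end /turn_position; congr (_ + _, _ + _); first exact: H.
(* The second coordinate is the first one for a start heading decreased by a right angle. *)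
have sc a : sin a = cos (a - PI / 2) by rewrite -cos_shift -cos_neg; congr cos; ring.
rewrite sc (_ : _ - _ = (th - PI / 2) + e * (b / 2)); last by ring.
rewrite -H; apply: RInt_ext => u _; rewrite sc; congr cos.
by rewrite /turn_heading; asR; ring.
Qed.

Lemma turn_end_headingE (b e th : R) : 0 < b ->
  turn_end_heading K e b th = th + e * b.
Proof.
move=> b0; rewrite /turn_end_heading /turn_heading.
rewrite RInt_Rscal ?turn_angle_total // => u.
exact: turn_curvature_continuous.
Qed.

End Turn.

(** * The length of short turns *)

Lemma cos_ge_quadratic (a : R) : 0 <= a <= PI / 2 -> 1 - a ^ 2 / 2 <= cos a.
Proof.
move=> [h1 h2]; have [h _] := cos_bound a 0 ltac:(lra) h2; move: h.
rewrite /cos_approx /cos_term /=; lra.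
Qed.

Lemma sin_ge_cubic (a : R) : 0 <= a <= PI -> a - a ^ 3 / 6 <= sin a.
Proof.
move=> [h1 h2]; have [h _] := sin_bound a 0 h1 h2; move: h.
rewrite /sin_approx /sin_term /=; lra.
Qed.

(** Otherwise [cos (16/10)] would be nonnegative, while its fourth-order Taylor upper bound is
    negative. *)
Lemma PI_lt_32 : PI < 32 / 10.
Proof.
apply: Rnot_le_lt => h.
have [_ H] := cos_bound (16/10) 0 ltac:(move: PI_RGT_0; lra) ltac:(lra).
have := cos_ge_0 (16/10) ltac:(move: PI_RGT_0; lra) ltac:(lra).
by move: H; rewrite /cos_approx /cos_term /=; lra.
Qed.

(* Here [28534 / 10000] exceeds [2 + t ^ 2 / 3] and [72 / 10 = 4 + 2 * t] for
   [t = 16 / 10 > PI / 2]. *)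
Lemma short_turn_poly1 (a : R) : 0 <= a <= 1 ->
  a * (28534 / 10000 - 72 / 10 * (a / 3 - a ^ 3 / 42))
  <= (1 - a ^ 2 / 2) * (4 - 72 / 100 * a ^ 2).
Proof. by move=> h; nra. Qed.

Lemma short_turn_poly2 (a : R) : 1 <= a <= 1385/1000 ->
  28534 / 10000 - 72 / 10 * (a / 3 - a ^ 3 / 42)
  <= (1 - a ^ 2 / 2) * (4 - 72 / 100 * a ^ 2).
Proof. by move=> h; nra. Qed.

Lemma short_turn_poly3 (a : R) : 1385/1000 <= a <= 16/10 ->
  28534 / 10000 - 72 / 10 * (a / 3 - a ^ 3 / 42) <= 0.
Proof.
move=> h; have h1 : 0 <= (a - 1385/1000) * (16/10 - a) by nra.
(* With [p], [q] the ends of the interval, [(a - p) * (a - q) * (a + p + q)] is [a ^ 3] minus its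
   secant there. Replacing the cube by the secant leaves a linear inequality. *)
have := Rmult_le_pos _ _ h1 (_ : 0 <= a + 2985/1000); lra.
Qed.

(** Expand [cos (a - w)] with [w = a * v ^ 2], bound [cos w] and [sin w] below by Taylor
    polynomials, and integrate in [v]. *)
Lemma turn_integral_ge (a : R) : 0 <= a <= PI / 2 ->
  cos a * (1 - a ^ 2 / 10) + sin a * (a / 3 - a ^ 3 / 42)
  <= RInt (fun v => cos (a * (1 - v ^ 2))) 0 1.
Proof.
move=> ha.
have -> : cos a * (1 - a ^ 2 / 10) + sin a * (a / 3 - a ^ 3 / 42)
  = RInt (fun v => cos a * (1 - (a * v ^ 2) ^ 2 / 2)
                   + sin a * (a * v ^ 2 - (a * v ^ 2) ^ 3 / 6)) 0 1.
  rewrite (RInt_antiderivative (F := fun v => cos a * (v - a ^ 2 * v ^ 5 / 10)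
                   + sin a * (a * v ^ 3 / 3 - a ^ 3 * v ^ 7 / 42))).
  - by asR; field.
  - by move=> v; auto_derive; [by [] | asR; field].
  - by cont_smooth.
apply: RInt_le; first lra; try by apply: ex_RInt_cont; cont_smooth.
move=> v hv.
have v2 : 0 <= v ^ 2 <= 1 by nra.
have hav : 0 <= a * v ^ 2 <= a by split; nra.
have -> : a * (1 - v ^ 2) = a - a * v ^ 2 by ring.
rewrite cos_minus.
have c0 : 0 <= cos a by apply: cos_ge_0; lra.
have sa : 0 <= sin a by apply: sin_ge_0; lra.
have h1 := cos_ge_quadratic (a := a * v ^ 2) ltac:(lra).
have h2 := sin_ge_cubic (a := a * v ^ 2) ltac:(lra).
by apply: Rplus_le_compat; apply: Rmult_le_compat_l.
Qed.

(* With [a = b / 2] and [t = theta_lim / 2], this bounds the length of a turn of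
   angle [b < theta_lim], in units of [/ kmax], by [PI + 1 + theta_lim]. *)
Lemma short_turn_trig (a t : R) : 0 <= a <= t -> t < PI / 2 ->
  2 * (t * cos a + (1 + t ^ 2 / 6) * sin a)
  <= (PI + 1 + 2 * t) * RInt (fun v => cos (a * (1 - v ^ 2))) 0 1.
Proof.
move=> [a0 at_] tp; have p2 := PI_lt_32; have p3 := PI2_3_2.
have I0 := turn_integral_ge (a := a) ltac:(lra).
set I := RInt _ _ _ in I0 *.
have c0 : 0 <= cos a by apply: cos_ge_0; lra.
have sa : 0 <= sin a by apply: sin_ge_0; lra.
have s1 : sin a <= 1 by case: (SIN_bound a).
have sa' : sin a <= a.
  by case: (Rle_lt_or_eq_dec _ _ a0) => [/sin_lt_x|<-]; rewrite ?sin_0; lra.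
have cq := cos_ge_quadratic (a := a) ltac:(lra).
set C := cos a in I0 c0 cq *; set S := sin a in I0 sa s1 sa' *.
set r := a / 3 - a ^ 3 / 42 in I0.
have hr : 0 <= r <= a / 3 by rewrite /r; split; nra.
have hP : 4 - 72 / 100 * a ^ 2 <= (4 + 2 * t) * (1 - a ^ 2 / 10) - 2 * t by nra.
(* The left side is nondecreasing in [t] because [r <= a / 3 <= t / 3], so [t] may be raised to
   16/10. *)
have hQ : 2 + t ^ 2 / 3 - (4 + 2 * t) * r <= 28534 / 10000 - 72 / 10 * r by nra.
have I1 : 0 <= I.
  apply: (Rle_trans _ _ _ _ I0); apply: Rplus_le_le_0_compat.
    by apply: Rmult_le_pos => //; nra.
  by apply: Rmult_le_pos => //; lra.
(* The 4 comes from [3 < PI]. *)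
apply: (Rle_trans _ ((4 + 2 * t) * I)); last by apply: Rmult_le_compat_r; lra.
apply: (Rle_trans _ ((4 + 2 * t) * (C * (1 - a ^ 2 / 10) + S * r))); last first.
  by apply: Rmult_le_compat_l; lra.
suff H : S * (28534 / 10000 - 72 / 10 * r) <= C * (4 - 72 / 100 * a ^ 2).
  have := Rmult_le_compat_l _ _ _ c0 hP.
  have := Rmult_le_compat_l _ _ _ sa hQ; lra.
have a2 : 0 <= 4 - 72 / 100 * a ^ 2 by nra.
have hC := Rmult_le_compat_r _ _ _ a2 cq.
have hC0 := Rmult_le_pos _ _ c0 a2.
(* If the factor of [S] is nonpositive the claim is clear. Otherwise [S] is bounded by [a] for
   [a <= 1] and by 1 beyond; from 1385/1000 on the factor is nonpositive anyway. *)
case: (Rle_dec (28534 / 10000 - 72 / 10 * r) 0) => hq.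
  have ? : S * (28534 / 10000 - 72 / 10 * r) <= 0 by nra.
  lra.
have {}hq := Rlt_le _ _ (Rnot_le_lt _ _ hq).
case: (Rle_dec a 1) => a1.
  have := Rmult_le_compat_r _ _ _ hq sa'; have := short_turn_poly1 (conj a0 a1).
  by rewrite -/r; lra.
case: (Rle_dec a (1385/1000)) => a3.
  have := Rmult_le_compat_r _ _ _ hq s1; have := @short_turn_poly2 a ltac:(lra).
  by rewrite -/r; lra.
have := Rmult_le_compat_r _ _ _ hq s1; have := @short_turn_poly3 a ltac:(lra).
by rewrite -/r; lra.
Qed.

Section TurnBound.
Variable K : limits.
Hypothesis hK : admissible K.

Let k0 : 0 < kmax K. Proof. by case: hK. Qed.
Let s0 : 0 < smax K. Proof. by case: hK => _ []. Qed.
Let thpi : theta_lim K < PI. Proof. by case: hK => _ []. Qed.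

Lemma turn_length_le (b B : R) : 0 < b <= B -> PI <= B ->
  turn_length K b <= B / kmax K + kmax K / smax K + R_T K.
Proof.
move=> hb hB; have k00 := k0; have s00 := s0; have thp := thpi.
have ki : 0 < / kmax K by exact: Rinv_0_lt_compat.
have T0 := R_T_gt0 hK.
case: (Rle_dec (theta_lim K) b) => ht.
  rewrite turn_length_long //.
  have := Rmult_le_compat_r _ _ _ (Rlt_le _ _ ki) (proj2 hb).
  by rewrite -!/(Rdiv _ _); lra.
have hb' : 0 < b < theta_lim K by lra.
have [sp E] := sharpnessP hK hb'.
have I0 := sharpness_integral_gt0 hK (b := b) ltac:(lra).
have T1 := short_turn_trig (a := b / 2) (t := theta_lim K / 2) ltac:(lra) ltac:(lra).
move: E; rewrite -turn_length_short // Rmult_assoc R_T_sin_add // => E.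
set I := RInt _ _ _ in E I0 T1.
(* The three terms are absorbed by [B / kmax K], by [R_T K >= y_Omega K >= / kmax K], and by
   [kmax K / smax K]. *)
apply: (Rle_trans _ ((PI + 1 + theta_lim K) / kmax K)); last first.
  have <- : theta_lim K / kmax K = kmax K / smax K by rewrite /theta_lim; field; lra.
  have := Rmult_le_compat_r _ _ _ (Rlt_le _ _ ki) hB.
  have := y_Omega_ge hK; have := R_T_ge_y hK.
  by rewrite /Rdiv; lra.
apply: (Rmult_le_reg_r I) => //; rewrite [X in X <= _]E.
have c0 : 0 <= cos (b / 2) by apply: cos_ge_0; lra.
have sa : 0 <= sin (b / 2) by apply: sin_ge_0; lra.
have := Rmult_le_compat_r _ _ _ c0 (x_Omega_le hK).
have := Rmult_le_compat_r _ _ _ sa (y_Omega_le hK).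
have := Rmult_le_compat_r _ _ _ (Rlt_le _ _ ki) T1.
rewrite /Rdiv => h1 h2 h3.
have e1 : theta_lim K * / 2 * / kmax K * cos (b * / 2)
   + (1 + theta_lim K ^ 2 * / 24) * / kmax K * sin (b * / 2)
   = (theta_lim K * / 2 * cos (b * / 2)
      + (1 + (theta_lim K * / 2) ^ 2 * / 6) * sin (b * / 2)) * / kmax K by field; lra.
have e2 : (PI + 1 + 2 * (theta_lim K * / 2)) = (PI + 1 + theta_lim K) by field.
move: h1; rewrite e2 => h1; lra.
Qed.

End TurnBound.

(** * Bounds for a leg *)

Lemma dist_euclidean (p q : point) : dist p q = dist_euc p.1 p.2 q.1 q.2.
Proof. by rewrite /dist /dist_euc /Rsqr; congr sqrt; ring. Qed.

Lemma dist_triangle (r p q : point) : dist p q <= dist p r + dist r q.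
Proof. rewrite !dist_euclidean; exact: triangle. Qed.

Lemma dist_ge0 (p q : point) : 0 <= dist p q.
Proof. exact: sqrt_pos. Qed.

Lemma dist_sqr (p q : point) :
  dist p q ^ 2 = (q.1 - p.1) ^ 2 + (q.2 - p.2) ^ 2.
Proof. by rewrite /dist pow2_sqrt //; apply: Rplus_le_le_0_compat; apply: pow2_ge_0. Qed.

Lemma dist_ray (p : point) (s th : R) : 0 <= s ->
  dist p (p.1 + s * cos th, p.2 + s * sin th) = s.
Proof.
move=> s0; rewrite -[RHS]sqrt_pow2 // /dist; congr sqrt; cbn [fst snd].
have := sin2_cos2 th; rewrite /Rsqr => E.
transitivity (s ^ 2 * (sin th * sin th + cos th * cos th)); first by ring.
by rewrite E; ring.
Qed.

(** The unit velocity is paired with the chord vector [(X, Y)]. The integral of this product is the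
    squared chord, and by Cauchy-Schwarz the integrand is at most the chord. *)
Lemma turn_position_dist (K : limits) (hK : admissible K) (e b : R) (p : point)
    (th l : R) : 0 <= l -> dist p (turn_position K e b p th l) <= l.
Proof.
move=> l0.
have ch x : continuous (turn_heading K e b th) x.
  apply: (continuous_plus (V := R_NormedModule)); first exact: continuous_const.
  apply: continuous_RInt0 => u; apply: (continuous_mult (K := R_AbsRing)).
    exact: continuous_const.
  exact: turn_curvature_continuous.
have cc x : continuous (fun u => cos (turn_heading K e b th u)) x.
  exact: continuous_cos_comp.
have cs x : continuous (fun u => sin (turn_heading K e b th u)) x.
  exact: continuous_sin_comp.
set q := turn_position _ _ _ _ _ _.
set X := RInt (fun u => cos (turn_heading K e b th u)) 0 l.
set Y := RInt (fun u => sin (turn_heading K e b th u)) 0 l.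
have E : dist p q ^ 2 = X * X + Y * Y.
  by rewrite dist_sqr /q /turn_position /= -/X -/Y; ring.
have N0 := dist_ge0 p q.
suff : dist p q * dist p q <= dist p q * l.
  case: N0 => [N0|<-] // H; exact: (Rmult_le_reg_l (dist p q)).
have -> : dist p q * dist p q = RInt (fun u => X * cos (turn_heading K e b th u)
     - (- Y) * sin (turn_heading K e b th u)) 0 l.
  rewrite RInt_Rminus; first last.
  - by move=> x; apply: (continuous_mult (K := R_AbsRing)); [exact: continuous_const | exact: cs].
  - by move=> x; apply: (continuous_mult (K := R_AbsRing)); [exact: continuous_const | exact: cc].
  by rewrite !RInt_Rscal // -/X -/Y; lra.
have <- : RInt (fun=> dist p q) 0 l = dist p q * l.
  by rewrite RInt_const /scal /= /mult /=; asR; ring.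
apply: RInt_le => //.
- apply: ex_RInt_cont => x; apply: (continuous_minus (V := R_NormedModule)).
    by apply: (continuous_mult (K := R_AbsRing)); [exact: continuous_const | exact: cc].
  by apply: (continuous_mult (K := R_AbsRing)); [exact: continuous_const | exact: cs].
- by apply: ex_RInt_cont => x; apply: continuous_const.
move=> u _; set c := cos _; set s := sin _.
have cs1 : s * s + c * c = 1 by exact: sin2_cos2.
have : (X * c - - Y * s) ^ 2 <= dist p q ^ 2.
  rewrite E.
  have -> : X * X + Y * Y = (X * X + Y * Y) * (s * s + c * c) by rewrite cs1; ring.
  have := pow2_ge_0 (X * s - Y * c); lra.
by move=> H; apply: Rnot_lt_le => H'; nra.
Qed.

Lemma dist_le_leg_length (K : limits) (hK : admissible K) (p : point) (th : R)
    (g : point) : dist p g <= leg_length K p th g.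
Proof.
apply: Rle_trans (dist_triangle (turn_end K (leg_side p th g) (turn_angle K p th g) p th) _ _) _.
by apply: Rplus_le_compat_r; apply: turn_position_dist => //; apply: turn_length_ge0.
Qed.

(** * The goal in the start frame, and the turn angle *)

Lemma polar_angle (u v : R) : u ^ 2 + v ^ 2 = 1 ->
  exists2 a, 0 <= a < 2 * PI & cos a = u /\ sin a = v.
Proof.
move=> E; have hu : -1 <= u <= 1 by nra.
have [a0 aP] := acos_bound u; have p0 := PI_RGT_0.
have sE : sin (acos u) = Rabs v.
  rewrite sin_acos // -sqrt_Rsqr_abs; congr sqrt; rewrite /Rsqr; lra.
case: (Rle_dec 0 v) => hv.
  exists (acos u); first lra.
  by rewrite cos_acos // sE Rabs_right //; lra.
exists (2 * PI - acos u).
  split; first lra.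
  case: a0 => [|a0]; first lra.
  by move: sE; rewrite -a0 sin_0 Rabs_left; lra.
have hn a : cos (2 * PI - a) = cos a /\ sin (2 * PI - a) = - sin a.
  by rewrite cos_minus sin_minus cos_2PI sin_2PI; split; ring.
by have [-> ->] := hn (acos u); rewrite cos_acos // sE Rabs_left; lra.
Qed.

(* Coordinates in the start frame, mirrored for right turns. *)
Definition frame_x (p : point) (th : R) (g : point) : R :=
  cos th * (g.1 - p.1) + sin th * (g.2 - p.2).

Definition frame_y (p : point) (th : R) (g : point) : R :=
  leg_side p th g * (cos th * (g.2 - p.2) - sin th * (g.1 - p.1)).

Lemma leg_side_cases (p : point) (th : R) (g : point) :
  leg_side p th g = 1 \/ leg_side p th g = -1.
Proof. by rewrite /leg_side; case: Rle_dec => h /=; [left | right]. Qed.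

Lemma frame_y_ge0 (p : point) (th : R) (g : point) : 0 <= frame_y p th g.
Proof. by rewrite /frame_y /leg_side; case: Rle_dec => h /=; lra. Qed.

Lemma frame_dist (p : point) (th : R) (g : point) :
  frame_x p th g ^ 2 + frame_y p th g ^ 2 = dist p g ^ 2.
Proof.
rewrite dist_sqr /frame_x /frame_y.
set u := g.1 - p.1; set v := g.2 - p.2.
have := sin2_cos2 th; rewrite /Rsqr => E.
transitivity ((u ^ 2 + v ^ 2) * (sin th * sin th + cos th * cos th)); last first.
  by rewrite E; ring.
by case: (leg_side_cases p th g) => ->; ring.
Qed.

Section Frame.
Variable K : limits.
Hypothesis hK : admissible K.

Let x := x_Omega K.
Let y := y_Omega K.
Let x0 : 0 < x. Proof. exact: x_Omega_gt0. Qed.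
Let y0 : 0 < y. Proof. exact: y_Omega_gt0. Qed.

(** Relative to the centre [(x, y)], the turn ends at [(x, - y)] rotated by [b], and the segment
    lengthens the first coordinate to [s + x]. So the line of the segment is tangent to the circle
    of radius [y] about the centre. *)
Lemma ray_end_frame (p : point) (th : R) (g : point) (b s : R) : 0 < b ->
  let e := leg_side p th g in
  g = ((turn_end K e b p th).1 + s * cos (turn_end_heading K e b th),
       (turn_end K e b p th).2 + s * sin (turn_end_heading K e b th)) <->
  frame_x p th g = x + (s + x) * cos b + y * sin b /\
  frame_y p th g = y + (s + x) * sin b - y * cos b.
Proof.
move=> b0 e; have he := leg_side_cases p th g; rewrite -/e in he.
rewrite turn_end_headingE // turn_endE //=.
have h2 : b = 2 * (b / 2) by field.
have cE a : cos (th + e * a) = cos th * cos a - e * (sin th * sin a).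
  rewrite cos_plus; case: he => ->; first by rewrite !Rmult_1_l.
  have -> : -1 * a = - a by ring.
  by rewrite cos_neg sin_neg; ring.
have sE a : sin (th + e * a) = sin th * cos a + e * (cos th * sin a).
  rewrite sin_plus; case: he => ->; first by rewrite !Rmult_1_l.
  have -> : -1 * a = - a by ring.
  by rewrite cos_neg sin_neg; ring.
rewrite !cE !sE -/x -/y.
have cb : cos b = 2 * cos (b / 2) * cos (b / 2) - 1 by rewrite {1}h2 cos_2a_cos.
have sb : sin b = 2 * sin (b / 2) * cos (b / 2) by rewrite {1}h2 sin_2a.
have q2 : sin (b / 2) * sin (b / 2) = 1 - cos (b / 2) * cos (b / 2).
  by have := sin2_cos2 (b / 2); rewrite /Rsqr; lra.
set A := x + (s + x) * cos b + y * sin b.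
set B := y + (s + x) * sin b - y * cos b.
have EA : 2 * (x * cos (b / 2) + y * sin (b / 2)) * cos (b / 2) + s * cos b = A.
  by rewrite /A sb cb; ring.
have EB : 2 * (x * cos (b / 2) + y * sin (b / 2)) * sin (b / 2) + s * sin b = B.
  rewrite /B sb cb; ring_simplify.
  have -> : sin (b / 2) ^ 2 = 1 - cos (b / 2) * cos (b / 2) by rewrite -q2; ring.
  by ring.
have t2 := sin2_cos2 th; rewrite /Rsqr in t2.
have -> : p.1 + 2 * (x * cos (b / 2) + y * sin (b / 2)) *
      (cos th * cos (b / 2) - e * (sin th * sin (b / 2))) +
     s * (cos th * cos b - e * (sin th * sin b)) =
    p.1 + cos th * A - e * sin th * B by rewrite -EA -EB; ring.
have -> : p.2 + 2 * (x * cos (b / 2) + y * sin (b / 2)) *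
      (sin th * cos (b / 2) + e * (cos th * sin (b / 2))) +
     s * (sin th * cos b + e * (cos th * sin b)) =
    p.2 + sin th * A + e * cos th * B by rewrite -EA -EB; ring.
have e2 : e * e = 1 by case: he => ->; ring.
rewrite /frame_x /frame_y -/e; split.
  case: g @e he cE sE e2 => g1 g2 e he cE sE e2 /= [-> ->]; split.
    transitivity (A * (sin th * sin th + cos th * cos th)); first by ring.
    by rewrite t2; ring.
  transitivity (e * e * B * (sin th * sin th + cos th * cos th)); first by ring.
  by rewrite t2 e2; ring.
move=> [<- <-]; rewrite {1}(surjective_pairing g); congr (_, _).
  transitivity (p.1 + (sin th * sin th + cos th * cos th) * (g.1 - p.1)
     + (1 - e * e) * sin th * (cos th * (g.2 - p.2) - sin th * (g.1 - p.1))).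
    by rewrite t2 e2; ring.
  by ring.
transitivity (p.2 + (sin th * sin th + cos th * cos th) * (g.2 - p.2)
     - (1 - e * e) * cos th * (cos th * (g.2 - p.2) - sin th * (g.1 - p.1))).
  by rewrite t2 e2; ring.
by ring.
Qed.

(** At angle 0 the formula of [turn_endE] would give a chord [2 * x_Omega K], while the empty turn
    ends where it starts; hence the separate case. *)
Lemma turn_end0 (e : R) (p : point) (th : R) :
  turn_length K 0 = 0 /\ turn_end K e 0 p th = p /\ turn_end_heading K e 0 th = th.
Proof.
have T0 : turn_length K 0 = 0.
  have := theta_lim_gt0 hK; rewrite /turn_length => h.
  case: Rle_dec => h1 /=; first lra.
  by case: Rlt_dec => h2 /=; lra.
rewrite /turn_end /turn_end_heading /turn_position /turn_heading T0 !RInt_point.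
rewrite /zero /= !Rplus_0_r; split => //; split => //.
by case: p.
Qed.

(** A goal farther than [2 * R_T K] is at least [R_T K] away from the centre, so the tangent length
    [q] is at least [x]. The angle [b] is the one that rotates [(q, - y)] onto [(u, v)], and
    [s = q - x]. *)
Lemma turn_angleP (p : point) (th : R) (g : point) : 2 * R_T K < dist p g ->
  is_turn_angle K p th g (turn_angle K p th g).
Proof.
move=> hl; apply: epsilon_spec.
have E := frame_dist p th g; have T2 := R_T_sqr K; have T0 := R_T_gt0 hK.
have l2 : 4 * R_T K ^ 2 < dist p g ^ 2 by nra.
pose u := frame_x p th g - x; pose v := frame_y p th g - y.
have D : x ^ 2 + y ^ 2 <= u ^ 2 + v ^ 2.
  have := pow2_ge_0 (frame_x p th g - 2 * x).
  have := pow2_ge_0 (frame_y p th g - 2 * y).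
  by rewrite /u /v; rewrite -/x -/y in T2; nra.
pose q := sqrt (u ^ 2 + v ^ 2 - y ^ 2).
have q2 : q ^ 2 = u ^ 2 + v ^ 2 - y ^ 2 by rewrite /q pow2_sqrt //; nra.
have qx : x <= q.
  by rewrite -[x]sqrt_pow2; [apply: sqrt_le_1_alt | ]; move: x0; lra.
have D0 : 0 < u ^ 2 + v ^ 2 by nra.
have unit : ((q * u - y * v) / (u ^ 2 + v ^ 2)) ^ 2
    + ((y * u + q * v) / (u ^ 2 + v ^ 2)) ^ 2 = 1.
  transitivity ((q ^ 2 + y ^ 2) / (u ^ 2 + v ^ 2)); first by field; lra.
  by rewrite q2; field; lra.
have [b [b0 b2] [cb sb]] := polar_angle unit.
have xE : frame_x p th g = x + q * cos b + y * sin b.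
  rewrite cb sb; transitivity (x + u * (q ^ 2 + y ^ 2) / (u ^ 2 + v ^ 2)).
    by rewrite q2 /u; field; rewrite -/u; lra.
  by field; lra.
have yE : frame_y p th g = y + q * sin b - y * cos b.
  rewrite cb sb; transitivity (y + v * (q ^ 2 + y ^ 2) / (u ^ 2 + v ^ 2)).
    by rewrite q2 /v; field; rewrite -/v; lra.
  by field; lra.
exists b; split; first by split.
case: b0 => b0.
  exists (q - x); first lra.
  apply/ray_end_frame => //.
  by rewrite (_ : q - x + x = q) //; ring.
(* For [b = 0] the goal is straight ahead, and the segment covers the whole distance [x + q]. *)
rewrite -b0 in xE yE *; have [_ [-> ->]] := turn_end0 (leg_side p th g) p th.
rewrite cos_0 sin_0 in xE yE.
exists (x + q); first by move: x0; lra.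
have t2 := sin2_cos2 th; rewrite /Rsqr in t2.
have w0 : cos th * (g.2 - p.2) - sin th * (g.1 - p.1) = 0.
  by move: yE; rewrite /frame_y; case: (leg_side_cases p th g) => ->; lra.
have -> : x + q = frame_x p th g by lra.
rewrite {1}(surjective_pairing g) /frame_x; congr (_, _).
  transitivity (p.1 + (sin th * sin th + cos th * cos th) * (g.1 - p.1)
    + sin th * (cos th * (g.2 - p.2) - sin th * (g.1 - p.1))).
    by rewrite t2 w0; ring.
  by ring.
transitivity (p.2 + (sin th * sin th + cos th * cos th) * (g.2 - p.2)
    - cos th * (cos th * (g.2 - p.2) - sin th * (g.1 - p.1))).
  by rewrite t2 w0; ring.
by ring.
Qed.

(* In terms of [a := b / 2 - PI / 2] the claim is [(l + x) tan a <= y]. With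
   [A := y cos a - x sin a] it reads [l sin a <= A], which follows from
   [A^2 - l^2 sin^2 a = (A - s sin a) (A (1 - 4 sin^2 a) + s sin a)]. *)
Lemma turn_angle_le (X Y l b s : R) : 0 < b < 2 * PI -> 0 <= s -> 0 <= Y ->
  X = x + (s + x) * cos b + y * sin b ->
  Y = y + (s + x) * sin b - y * cos b ->
  X ^ 2 + Y ^ 2 = l ^ 2 -> 2 * R_T K < l ->
  b <= PI + 2 * atan (y / (l + x)).
Proof.
move=> hb s0 Y0 XE YE lE hl; have p0 := PI_RGT_0; have x00 := x0; have y00 := y0.
have T0 := R_T_gt0 hK; have T2 := R_T_sqr K; rewrite -/x -/y in T2.
have z0 : 0 < y / (l + x) by apply: Rdiv_lt_0_compat; lra.
have at0 : 0 < atan (y / (l + x)) by rewrite -atan_0; apply: atan_increasing.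
case: (Rle_dec b PI) => hbp; first lra.
pose a := b / 2 - PI / 2.
have ha : 0 < a < PI / 2 by rewrite /a; lra.
suff : a <= atan (y / (l + x)) by rewrite /a; lra.
have bE : b = 2 * a + PI by rewrite /a; field.
have c0 : 0 < cos a by apply: cos_gt_0; lra.
have sn0 : 0 < sin a by apply: sin_gt_0; lra.
have cs1 : sin a * sin a + cos a * cos a = 1 by exact: sin2_cos2.
have cb : cos b = 2 * sin a * sin a - 1 by rewrite bE neg_cos cos_2a_sin; ring.
have sb : sin b = - (2 * sin a * cos a) by rewrite bE neg_sin sin_2a.
pose A := y * cos a - x * sin a.
have X1 : X = - s - 2 * sin a * (A - s * sin a) by rewrite XE cb sb /A; ring.
have Y1 : Y = 2 * cos a * (A - s * sin a).
  transitivity (2 * y * (1 - sin a * sin a) - 2 * (s + x) * sin a * cos a).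
    by rewrite YE cb sb; ring.
  by rewrite -cs1 /A; ring.
(* As [cos a > 0], this is the condition that the goal lies on the side of the turn. *)
have As : s * sin a <= A.
  by apply: Rnot_lt_le => h; have := Rmult_lt_0_compat (2 * cos a) (s * sin a - A);
     move: Y0; rewrite Y1; lra.
have A2 : A ^ 2 <= R_T K ^ 2.
  have := pow2_ge_0 (y * sin a + x * cos a); rewrite T2.
  have -> : x ^ 2 + y ^ 2 = (x ^ 2 + y ^ 2) * (sin a * sin a + cos a * cos a).
    by rewrite cs1; ring.
  by rewrite /A; lra.
have l2 : l ^ 2 = s ^ 2 + 4 * A ^ 2 - 4 * A * s * sin a.
  transitivity ((s + 2 * sin a * (A - s * sin a)) ^ 2
     + 4 * (1 - sin a * sin a) * (A - s * sin a) ^ 2); last by ring.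
  by rewrite -lE X1 Y1 -cs1; ring.
(* Otherwise [l2] would give [l ^ 2 <= 4 * A ^ 2 <= 4 * R_T K ^ 2]. *)
have sA : 4 * A * sin a <= s.
  have : 4 * R_T K ^ 2 < l ^ 2 by nra.
  by move=> h; apply: Rnot_lt_le => h'; nra.
have A0 : 0 <= A by nra.
have lS : l * sin a <= A.
  apply: Rsqr_incr_0_var => //; rewrite /Rsqr.
  have : 0 <= A * (1 - 4 * sin a * sin a) + s * sin a by nra.
  move=> h; have := Rmult_le_pos (A - s * sin a) _ ltac:(lra) h.
  have -> : l * sin a * (l * sin a) = l ^ 2 * (sin a * sin a) by ring.
  by rewrite l2; lra.
apply: Rnot_lt_le => h.
have := tan_increasing (atan (y / (l + x))) a.
rewrite tan_atan => /(_ _ h) H.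
have {}H : y / (l + x) < tan a by apply: H; lra.
have := Rmult_lt_compat_r (cos a * (l + x)) _ _ ltac:(nra) H.
have -> : y / (l + x) * (cos a * (l + x)) = y * cos a by field; lra.
have -> : tan a * (cos a * (l + x)) = sin a * (l + x) by rewrite /tan; field; lra.
by move: lS; rewrite /A; lra.
Qed.

Lemma leg_length_le (p : point) (th : R) (g : point) :
  2 * R_T K < dist p g ->
  leg_length K p th g <=
  sqrt ((dist p g + R_T K) ^ 2 - R_M K ^ 2)
  + ((PI + 2 * atan (R_M K / (dist p g + R_T K * sin (gamma K)))) / kmax K
     + kmax K / smax K) + R_T K.
Proof.
move=> hl; have [[b0 b2] [s s0 sE]] := turn_angleP th hl.
rewrite R_M_y // R_T_sin_gamma // -/x -/y.
rewrite /leg_length; move: b0 b2 sE.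
set b := turn_angle K p th g => b0 b2 sE.
have T0 := R_T_gt0 hK; have T2 := R_T_sqr K; rewrite -/x -/y in T2.
have x00 := x0; have y00 := y0; have p0 := PI_RGT_0.
have z0 : 0 < y / (dist p g + x) by apply: Rdiv_lt_0_compat; lra.
have at0 : 0 < atan (y / (dist p g + x)) by rewrite -atan_0; apply: atan_increasing.
have lE := frame_dist p th g.
rewrite {2}sE dist_ray //.
have l0 := dist_ge0 p g.
set l := dist p g in hl z0 at0 lE l0 *.
have th0 := theta_lim_gt0 hK; have [k0 [sm0 _]] := hK.
have kp : 0 <= (PI + 2 * atan (y / (l + x))) / kmax K.
  by apply: Rlt_le; apply: Rdiv_lt_0_compat; lra.
have kq : 0 <= kmax K / smax K by apply: Rlt_le; apply: Rdiv_lt_0_compat.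
case: b0 => [hb|hb]; last first.
  have [T00 [E0 H0]] := turn_end0 (leg_side p th g) p th.
  rewrite -hb T00; rewrite -hb E0 H0 in sE.
  have -> : s = l by rewrite /l sE dist_ray.
  suff : l <= sqrt ((l + R_T K) ^ 2 - y ^ 2) by lra.
  by rewrite -[X in X <= _](sqrt_pow2 l l0); apply: sqrt_le_1_alt; nra.
move: sE => /(ray_end_frame p th g s hb) [XE YE].
have bB := turn_angle_le (conj hb b2) s0 (frame_y_ge0 p th g) XE YE lE hl.
have := turn_length_le hK (conj hb bB) ltac:(lra).
suff : s + x <= sqrt ((l + R_T K) ^ 2 - y ^ 2) by lra.
rewrite -[X in X <= _]sqrt_pow2; last lra.
apply: sqrt_le_1_alt.
set X := frame_x p th g in XE lE; set Y := frame_y p th g in YE lE.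
have D : (X - x) ^ 2 + (Y - y) ^ 2 = (s + x) ^ 2 + y ^ 2.
  transitivity (((s + x) ^ 2 + y ^ 2) * (sin b * sin b + cos b * cos b)).
    by rewrite XE YE; ring.
  by have := sin2_cos2 b; rewrite /Rsqr => ->; ring.
(* Cauchy-Schwarz, in place of the triangle inequality for the distance from the goal to the
   centre. *)
have CS : (X * x + Y * y) ^ 2 <= (l * R_T K) ^ 2.
  have -> : (l * R_T K) ^ 2 = (X ^ 2 + Y ^ 2) * (x ^ 2 + y ^ 2) by rewrite lE -T2; ring.
  by have := pow2_ge_0 (X * y - Y * x); lra.
have lR : 0 <= l * R_T K by nra.
have low (z w : R) : 0 <= w -> z ^ 2 <= w ^ 2 -> - w <= z.
  by move=> w0 h; apply: Rnot_lt_le => h'; nra.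
by have := low _ _ lR CS; lra.
Qed.

End Frame.

(** Divided by [l] and squared, the left side is [1 + 2 * r / l + (r ^ 2 - m ^ 2) / l ^ 2], which
    decreases in [l]. [h1] and [h2] compare its two varying terms after clearing denominators. *)
Lemma sqrt_ratio_antitone (l0 l r m : R) : 0 < l0 <= l -> 0 <= m <= r ->
  sqrt ((l + r) ^ 2 - m ^ 2) <= sqrt ((l0 + r) ^ 2 - m ^ 2) / l0 * l.
Proof.
move=> hl hm.
have -> : sqrt ((l0 + r) ^ 2 - m ^ 2) / l0 * l
    = sqrt (((l0 + r) ^ 2 - m ^ 2) * (l / l0) ^ 2).
  rewrite sqrt_mult; [|nra|nra]; rewrite sqrt_pow2; first by field; lra.
  by apply: Rlt_le; apply: Rdiv_lt_0_compat; lra.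
apply: sqrt_le_1_alt.
have -> : ((l0 + r) ^ 2 - m ^ 2) * (l / l0) ^ 2
   = ((l0 * l + r * l) ^ 2 - (m * l) ^ 2) / l0 ^ 2 by field; lra.
apply: (Rmult_le_reg_r (l0 ^ 2)); first by nra.
have -> : ((l0 * l + r * l) ^ 2 - (m * l) ^ 2) / l0 ^ 2 * l0 ^ 2
   = (l0 * l + r * l) ^ 2 - (m * l) ^ 2 by field; lra.
have h1 : 0 <= (l - l0) * (l * l0 * r).
  apply: Rmult_le_pos; first lra.
  by apply: Rmult_le_pos; [apply: Rmult_le_pos |]; lra.
have h2 : 0 <= (l ^ 2 - l0 ^ 2) * (r ^ 2 - m ^ 2) by apply: Rmult_le_pos; nra.
lra.
Qed.

(** * The graphs *)

Lemma sumR_ge0 (I : Type) (r : seq I) (P : pred I) (F : I -> R) :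
  (forall i, P i -> 0 <= F i) -> 0 <= \big[Rplus/0]_(i <- r | P i) F i.
Proof. by move=> F0; elim/big_ind: _ => // *; lra. Qed.

Lemma sumR_ge_term (I : finType) (F : I -> R) (i : I) :
  (forall j, 0 <= F j) -> F i <= \big[Rplus/0]_j F j.
Proof.
move=> F0; have := mem_index_enum i; elim: (index_enum I) => // j r IH.
rewrite inE big_cons => /orP[/eqP <-|/IH h]; last by have := F0 j; lra.
by have := sumR_ge0 r (fun j (_ : true) => F0 j); lra.
Qed.

(** * Polylines through the stops *)

Fixpoint polyline_length (p : point) (gs : seq point) : R :=
  if gs is g :: gs' then dist p g + polyline_length g gs' else 0.

Lemma polyline_length_shortcut (p q : point) (gs : seq point) :
  polyline_length p gs <= dist p q + polyline_length q gs.
Proof.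
case: gs => [|g gs] /=; first by have := dist_ge0 p q; lra.
by have := dist_triangle q p g; lra.
Qed.

(** Unlike [path_length], the polyline carries no headings, so each deleted stop costs only a
    triangle inequality. *)
Lemma polyline_length_filter (T : Type) (f : T -> point) (a : pred T)
    (p : point) (s : seq T) :
  polyline_length p (map f (filter a s)) <= polyline_length p (map f s).
Proof.
elim: s p => [|y s IH] p /=; first lra.
case: ifP => _ /=; first by have := IH (f y); lra.
apply: Rle_trans (polyline_length_shortcut _ (f y) _) _.
by have := IH (f y); lra.
Qed.

Lemma polyline_le_path_length (K : limits) (hK : admissible K) (p : point)
    (th : R) (gs : seq point) : polyline_length p gs <= path_length K p th gs.
Proof.
elim: gs p th => [|g gs IH] p th /=; first lra.
by have := dist_le_leg_length hK p th g; have := IH g (leg_heading K p th g); lra.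
Qed.

(** * Visitation orders under the standing assumptions *)

Section Scenario.
Variables (ng nip nt : nat) (D : scenario ng nip nt).
Hypothesis hD : standing_assumptions D.

Notation K := (lims D).

Lemma standing_admissible : admissible K.
Proof. by case: hD => [[k0 s0] [_ [_ [_ [_ [th _]]]]]]; split. Qed.

Let hK := standing_admissible.

Let lR : 2 * R_T K < l_min D.
Proof. by case: hD => _ [_ [_ [_ [_ []]]]]. Qed.

Lemma l_min_le (a b : site ng nip nt) : a != b ->
  l_min D <= dist (site_pos D a) (site_pos D b).
Proof.
move=> ab; rewrite /l_min; set E := (fun d : R => _).
have [lb glb] := Glb_Rbar_correct E.
have h1 := lb (dist (site_pos D a) (site_pos D b)) (ex_intro _ a (ex_intro _ b (conj ab erefl))).
(* With [h1] this makes the infimum finite, so that [real] does not replace it by its default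
   value. *)
have h0 : Rbar_le 0 (Glb_Rbar E).
  by apply: glb => _ [a' [b' [_ ->]]]; apply: dist_ge0.
by move: h0 h1; case: (Glb_Rbar E) => [r| |] //=; have := dist_ge0.
Qed.

Lemma beta_max_antitone (l0 l : R) : 0 < l0 <= l -> beta_max D l <= beta_max D l0.
Proof.
move=> hl; have x0 := x_Omega_gt0 hK; have y0 := y_Omega_gt0 hK.
rewrite /beta_max R_M_y // R_T_sin_gamma //.
case: (Rle_lt_or_eq_dec _ _ (proj2 hl)) => [h|->]; last lra.
have : atan (y_Omega K / (l + x_Omega K)) < atan (y_Omega K / (l0 + x_Omega K)).
  apply: atan_increasing; apply: Rmult_lt_compat_l => //.
  apply: Rinv_lt_contravar; last lra.
  by apply: Rmult_lt_0_compat; lra.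
by lra.
Qed.

Let l0 : 0 < l_min D.
Proof. by have := R_T_gt0 hK; have := lR; lra. Qed.

Let M_gt0 : 0 < beta_max D (l_min D) / kmax K + kmax K / smax K.
Proof.
have [k0 [s0 _]] := hK; have l00 := l0.
have x0 := x_Omega_gt0 hK; have y0 := y_Omega_gt0 hK.
apply: Rplus_lt_0_compat; apply: Rdiv_lt_0_compat => //.
rewrite /beta_max R_M_y // R_T_sin_gamma //.
have : 0 < atan (y_Omega K / (l_min D + x_Omega K)).
  by rewrite -atan_0; apply: atan_increasing; apply: Rdiv_lt_0_compat; lra.
by have := PI_RGT_0; lra.
Qed.

Lemma R_max_gt0 : 0 < R_max D.
Proof.
have T0 := R_T_gt0 hK; have l00 := l0; have M0 := M_gt0.
apply: Rplus_le_lt_0_compat.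
  by apply: Rmult_le_pos; [apply: sqrt_pos | apply: Rlt_le; apply: Rinv_0_lt_compat].
apply: Rdiv_lt_0_compat => //.
by have := Rmax_l (beta_max D (l_min D) / kmax K + kmax K / smax K)
   (466 / 100 * R_T K / l_min D); lra.
Qed.

Lemma leg_length_le_R_max (a b : site ng nip nt) (th : R) : a != b ->
  leg_length K (site_pos D a) th (site_pos D b)
  <= R_max D * dist (site_pos D a) (site_pos D b).
Proof.
move=> /l_min_le; set p := site_pos D a; set g := site_pos D b => hl.
have T0 := R_T_gt0 hK; have l00 := l0; have M0 := M_gt0; have lR0 := lR.
have [k0 [s0 _]] := hK.
apply: Rle_trans (leg_length_le hK th (_ : 2 * R_T K < dist p g)) _; first lra.
rewrite /R_max Rmult_plus_distr_r Rplus_assoc; apply: Rplus_le_compat.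
  apply: sqrt_ratio_antitone => //.
  by rewrite R_M_y //; have := y_Omega_gt0 hK; have := R_T_ge_y hK; lra.
(* The turn part of the bound does not grow with the distance, since [beta_max] is antitone; the
   factor [dist p g / l_min D >= 1] only helps. *)
set M := Rmax _ _.
have hM : beta_max D (l_min D) / kmax K + kmax K / smax K <= M by exact: Rmax_l.
have hb := beta_max_antitone (conj l0 hl).
have := Rmult_le_compat_r _ _ _ (Rlt_le _ _ (Rinv_0_lt_compat _ k0)) hb.
rewrite -!/(Rdiv _ _) => hb'.
apply: (Rle_trans _ (M + R_T K)); first by move: hM hb'; rewrite /beta_max; lra.
have -> : (M + R_T K) / l_min D * dist p g = (M + R_T K) * (dist p g / l_min D).
  by field; lra.
rewrite -[X in X <= _]Rmult_1_r; apply: Rmult_le_compat_l; first lra.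
apply: (Rmult_le_reg_r (l_min D)) => //.
by rewrite /Rdiv Rmult_assoc Rinv_l; lra.
Qed.

Lemma path_length_le_R_max (a : site ng nip nt) (th : R) (s : seq (site ng nip nt)) :
  uniq (a :: s) ->
  path_length K (site_pos D a) th (map (site_pos D) s)
  <= R_max D * polyline_length (site_pos D a) (map (site_pos D) s).
Proof.
elim: s a th => [|b s IH] a th; first by move=> _ /=; lra.
rewrite cons_uniq inE negb_or => /andP[/andP[ab _] us] /=.
have := leg_length_le_R_max th ab.
by have := IH b (leg_heading K (site_pos D a) th (site_pos D b)) us; lra.
Qed.

(** [l_min] ranges over pairs of distinct labels, so stops are turned into labels; the label of the
    start is never among them. *)
Definition stop_site (i : 'I_ng) (x : stop nip nt) : site ng nip nt :=
  if x is Some w then inl w else inr (inr i).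

Lemma stop_site_inj (i : 'I_ng) : injective (stop_site i).
Proof. by move=> [w|] [w'|] //= [->]. Qed.

Lemma S_L_le_R_max (i : 'I_ng) (lam : seq (stop nip nt)) : uniq lam ->
  S_L D i lam
  <= R_max D * polyline_length (start_pos D i) [seq stop_pos D i x | x <- lam].
Proof.
move=> u; rewrite /S_L.
have -> : [seq stop_pos D i x | x <- lam] = map (site_pos D) (map (stop_site i) lam).
  by rewrite -map_comp; apply: eq_map => -[].
apply: (path_length_le_R_max (a := inr (inl i))).
rewrite cons_uniq map_inj_uniq ?u ?andbT; last exact: stop_site_inj.
by apply/mapP => -[[w|]].
Qed.

(* Skipping stops shortens the polyline through the stops, which bounds the
   path length from below, and up to the factor [R_max] from above. *)
Lemma weak_S_L_filter (i : 'I_ng) (a : pred (stop nip nt)) (lam : seq (stop nip nt)) :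
  uniq lam -> weak_S_L D i (filter a lam) <= S_L D i lam.
Proof.
move=> u; have R0 := R_max_gt0.
apply: (Rmult_le_reg_r (R_max D)) => //.
rewrite /weak_S_L /Rdiv Rmult_assoc Rinv_l ?Rmult_1_r; last lra.
apply: Rle_trans (S_L_le_R_max i (filter_uniq a u)) _; rewrite Rmult_comm.
apply: Rmult_le_compat_r; first lra.
apply: Rle_trans (polyline_length_filter _ _ _ _) _.
exact: polyline_le_path_length.
Qed.

Lemma S_L_max_filter (i : 'I_ng) (xi : {set 'I_nip}) (lam : seq (stop nip nt)) :
  S_L_max D i (filter (allowed xi) lam) = S_L_max D i lam.
Proof.
rewrite /S_L_max; congr ((_ + _) / _).
by apply: eq_bigl => k; rewrite mem_filter.
Qed.

Lemma valid_filter (i : 'I_ng) (xi' xi'' : {set 'I_nip}) (lam : seq (stop nip nt)) :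
  valid D i xi'' lam -> weakly_valid D i xi' (filter (allowed xi') lam).
Proof.
rewrite /valid /weakly_valid; elim=> [|mu y _ IH ln lt]; first exact: lower_valid_root.
have [/and3P [u _ N]] := (ln).
(* If the appended stop is deleted, the filtered order is that of the parent. *)
rewrite filter_rcons; case: ifP => // ay.
have fE : filter (allowed xi') (rcons mu y) = rcons (filter (allowed xi') mu) y.
  by rewrite filter_rcons ay.
apply: lower_valid_child => //; rewrite -fE.
  rewrite /lower_node filter_uniq // filter_all fE size_rcons /= -cats1 take_size_cat //=.
  move: N; rewrite size_rcons /= -cats1 take_size_cat //.
  by rewrite mem_filter negb_and => ->.
rewrite S_L_max_filter; exact: Rle_lt_trans (weak_S_L_filter i _ u) lt.
Qed.

Lemma goal_filter (xi : {set 'I_nip}) (lam : seq (stop nip nt)) :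
  goal lam -> goal (filter (allowed xi) lam).
Proof.
case: (lastP lam) => // mu y; rewrite /goal last_rcons => /andP[_ /eqP ->].
by rewrite filter_rcons /= last_rcons eqxx andbT -size_eq0 size_rcons.
Qed.

(** The filter keeps the points of [xi'], so those missing afterwards were already missing from
    [lam]. *)
Lemma K_L_filter (xi' xi'' : {set 'I_nip}) (lam : seq (stop nip nt)) :
  xi' \subset xi'' ->
  (K_L (filter (allowed xi') lam) xi' <= K_L lam xi'')%N.
Proof.
move=> /subsetP sub; apply: subset_leq_card; apply/subsetP => j.
rewrite !inE mem_filter => /andP[jx]; rewrite /= jx => ->.
by rewrite sub.
Qed.

Lemma P_L_le_P_U (i : 'I_ng) : 0 <= P_L D i <= P_U D.
Proof.
have [_ [g0 [t0 [h0 _]]]] := hD.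
have tg : 0 < / tan (gamma_d D) by apply: Rinv_0_lt_compat; apply: tan_gt_0; lra.
have s1 : start_height D i <= \big[Rplus/0]_(j < ng) start_height D j.
  by apply: sumR_ge_term => j; apply: Rlt_le.
have s2 : 0 <= \big[Rplus/0]_(k < nt) th_gain D k.
  by apply: sumR_ge0 => k _; apply: Rlt_le.
have hi := h0 i; rewrite /P_L /P_U; split.
  by apply: Rmult_le_pos; lra.
by apply: Rmult_le_compat_r; lra.
Qed.

Lemma valid_uniq (i : 'I_ng) (xi : {set 'I_nip}) (lam : seq (stop nip nt)) :
  valid D i xi lam -> uniq lam.
Proof. by case=> // mu y _ /and3P[]. Qed.

Lemma weak_V_L_le (i : 'I_ng) (xi' xi'' : {set 'I_nip})
    (lam wlam : seq (stop nip nt)) :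
  xi' \subset xi'' ->
  optimal_order D i xi'' lam -> weak_optimal_order D i xi' wlam ->
  weak_V_L D i xi' wlam <= S_L D i lam + P_U D * INR (K_L lam xi'').
Proof.
move=> sub [[gl vl] _] [_ wopt].
have gf := goal_filter xi' gl.
apply: Rle_trans (wopt _ (conj gf (valid_filter xi' vl))) _.
rewrite /weak_V_L /lower_cost gf; apply: Rplus_le_compat.
  exact: weak_S_L_filter (valid_uniq vl).
have [PL0 PLU] := P_L_le_P_U i.
rewrite Rmult_comm; apply: Rmult_le_compat => //; first exact: pos_INR.
by apply: le_INR; apply/leP; apply: K_L_filter.
Qed.

End Scenario.

Lemma descendant_subset (ng nip : nat) (Xi Xi' : {ffun 'I_ng -> {set 'I_nip}}) :
  descendant Xi Xi' -> forall i, Xi i \subset Xi' i.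
Proof.
elim=> [Y Y' [i [j [_ ->]]] i'|Y Y1 Y2 _ IH1 _ IH2 i].
  by rewrite ffunE; case: ifP => // _; apply: subsetU1.
exact: subset_trans (IH1 i) (IH2 i).
Qed.

Theorem theorem3 (ng nip nt : nat) (D : scenario ng nip nt)
  (hD : standing_assumptions D)
  (lam wlam : 'I_ng -> {set 'I_nip} -> seq (stop nip nt))
  (Xi' Xi'' : {ffun 'I_ng -> {set 'I_nip}})
  (hXi' : upper_node Xi') (hXi'' : upper_node Xi'')
  (hdesc : descendant Xi' Xi'')
  (hwlam : forall i : 'I_ng, weak_optimal_order D i (Xi' i) (wlam i (Xi' i)))
  (hlam : forall i : 'I_ng, optimal_order D i (Xi'' i) (lam i (Xi'' i))) :
  (weak_upper_cost D wlam Xi' <= upper_cost D lam Xi'')%R.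
Proof.
rewrite /weak_upper_cost /upper_cost.
(* The relation [w <= s + P_U D * k] holds at 0 and is closed under addition, so the three sums are
   compared glider by glider. *)
elim/big_ind3: _ => [|w1 s1 k1 w2 s2 k2|i _]; try lra.
exact: weak_V_L_le (descendant_subset hdesc i) (hlam i) (hwlam i).
Qed.
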